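(* Work in the setting, notation and assumptions (A1)–(A2) of the context, with all similitudes $f_1,\dots,f_k$ having the common contraction ratio $q\in(0,1)$. Let $u^0\in X$, let $u$ be the mild solution on $Q$ of $\partial_tu=\mathbf Au$, $u(0,\cdot)=u^0$, let $\tilde u:=T^{-1}u$, $\tilde u^0:=T^{-1}u^0$, and for $\varepsilon>0$, $m\in\mathbb N$ let $\tilde u_{\varepsilon,m}$ be the solution of $$\partial_t\tilde u_{\varepsilon,m}(t,x)=\int_K\tilde\sigma_{\varepsilon,m}(x,y)\,\tilde u_{\varepsilon,m}(t,y)\,d\nu(y),\qquad \tilde u_{\varepsilon,m}(0,\cdot)=P_m\tilde u^0 .$$ Assume in addition that there exist $\alpha>0$ and $C>0$, independent of $\varepsilon$ and $m$, such that $$\|\tilde u^0-P_m\tilde u^0\|_{L^2(K,\nu)}+\|\tilde\sigma_\varepsilon-\tilde\sigma_{\varepsilon,m}\|_{L^2(K\times K,\nu\times\nu)}\le Cq^{\alpha m},$$ and that $r(\varepsilon)\le C\varepsilon^\beta$ for some $\beta>0$. Then for every $\mathsf T>0$ (such that $u(t,\cdot)\in X$ for all $t\in[0,\mathsf T]$) there is a constant $C_{\mathsf T}$, independent of $\varepsilon$ and $m$, such that $$\|\tilde u_{\varepsilon,m}-\tilde u\|_{C([0,\mathsf T];L^2(K,\nu))}\le C_{\mathsf T}\big(\varepsilon^\beta+q^{\alpha m}\big).$$ If $m=m(\varepsilon)$ is chosen so that $q^{\alpha m(\varepsilon)}\le\varepsilon^\beta<q^{\alpha(m(\varepsilon)-1)}$,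 then $$\|\tilde u_{\varepsilon,m(\varepsilon)}-\tilde u\|_{C([0,\mathsf T];L^2(K,\nu))}\le C_{\mathsf T}\,\varepsilon^\beta$$ (with a possibly different constant $C_{\mathsf T}$ of the same kind). Equivalently, writing $N_m=k^m$ and $s=\log k/\log(1/q)$, so that $q^m=N_m^{-1/s}$, the balanced choice $\varepsilon\asymp N_m^{-\alpha/(\beta s)}$ yields $$\|\tilde u_{\varepsilon,m}-\tilde u\|_{C([0,\mathsf T];L^2(K,\nu))}\le C_{\mathsf T}\,N_m^{-\alpha/s}.$$
   Context: Self-similar set. Let $f_1,\dots,f_k:\mathbb R^d\to\mathbb R^d$ be similitudes with $|f_i(x)-f_i(y)|=q|x-y|$, $0<q<1$, and let $K$ be their attractor, the unique nonempty compact set with $K=\bigcup_{i=1}^k f_i(K)$. Let $\Sigma=\{1,\dots,k\}^{\mathbb N}$, let $\Sigma_m$ be the set of words of length $m$, and for $w=w_1\cdots w_m\in\Sigma_m$ put $f_w=f_{w_1}\circ\cdots\circ f_{w_m}$, $K_w=f_w(K)$; write $|w|=m$. The natural projection $\pi_K:\Sigma\to K$ sends $(w_1w_2\dots)$ to the unique point of $\bigcap_{n\ge1}K_{w_1\cdots w_n}$. Let $\mu$ be the uniform Bernoulli measure on $\Sigma$ (each cylinder of length $n$ has measure $k^{-n}$), and $\nu=(\pi_K)_*\mu$. Standing assumption: the set of $w\in\Sigma$ such that $\pi_K^{-1}(\pi_K(w))$ has more than one element is $\mu$-null. Reference interval. Let $Q=[0,1]$, $g_i(x)=\frac{x}{k}+\frac{i-1}{k}$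 for $i=1,\dots,k$, and let $\pi_Q:\Sigma\to Q$ be the natural projection of this IFS; $\lambda=(\pi_Q)_*\mu$ is Lebesgue measure on $[0,1]$. There are full-measure sets $Q_0\subset Q$, $K_0\subset K$ and a measure-preserving bijection $\Phi:Q_0\to K_0$ with $\Phi\circ\pi_Q=\pi_K$ $\mu$-a.e. The operator $T:L^2(K,\nu;\mathbb R^p)\to L^2(Q,\lambda;\mathbb R^p)$, $Tf=f\circ\Phi$ (a.e.), is a surjective linear isometry, with $T^{-1}g=g\circ\Phi^{-1}$ (a.e.). Here $p\ge1$ is a fixed integer; $L^2(Q)$ abbreviates $L^2(Q,\lambda;\mathbb R^p)$, and functions on $K$ are also $\mathbb R^p$-valued. Reference operator and approximation. $\mathbf A$ is a densely defined linear operator on $L^2(Q)$ with domain $\mathcal D(\mathbf A)$, generating a $C_0$-semigroup. For $\varepsilon>0$, $\mathbf A_\varepsilon$ is the integral operator $(\mathbf A_\varepsilon v)(x)=\int_Q\sigma_\varepsilon(x,y)v(y)\,dy$ with kernel $\sigma_\varepsilon\in L^2(Q\times Q)$ ($p\times p$ matrix-valued if $p>1$). $X$ is a Banach space with $X\hookrightarrow L^2(Q)$ densely and continuously and $X\subset\mathcal D(\mathbf A)$. It is assumed that there exist a dense subspace $\mathcal D_0\subset X$ which is a core for $\mathbf A$ and a function $r(\varepsilon)\to0$ as $\varepsilon\to0$ such that: (A1) (uniform semigroup stability) for every $\varepsilon>0$, $\mathbf A_\varepsilon$ generates a $C_0$-semigroup $(S_\varepsilon(t))_{t\ge0}$ on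 $L^2(Q)$ and there are $M\ge1$, $\omega\in\mathbb R$ independent of $\varepsilon$ with $\|S_\varepsilon(t)\|_{\mathcal L(L^2(Q))}\le Me^{\omega t}$ for all $t\ge0$; (A2) (consistency) $\|\mathbf A_\varepsilon\varphi-\mathbf A\varphi\|_{L^2(Q)}\le r(\varepsilon)\|\varphi\|_X$ for all $\varphi\in\mathcal D_0$. Lift and discretization. $\tilde\sigma_\varepsilon(x,y)=\sigma_\varepsilon(\Phi^{-1}(x),\Phi^{-1}(y))$ for $(x,y)\in K_0\times K_0$ and $0$ otherwise. $P_m$ is the $L^2(K,\nu)$-orthogonal projector onto the span of the indicators $\mathbf 1_{K_w}$, $|w|=m$ (with $\mathbb R^p$ coefficients). $\tilde\sigma_{\varepsilon,m}=\sum_{|w|=|v|=m}\tilde\sigma^{(\varepsilon)}_{wv}\,\mathbf 1_{K_w\times K_v}$, where $\tilde\sigma^{(\varepsilon)}_{wv}$ is the average of $\tilde\sigma_\varepsilon$ over $K_w\times K_v$ with respect to $\nu\times\nu$. Conventions. $a\asymp b$ means that $a/b$ is bounded above and below by positive constants. $C_{\mathsf T}$ may depend on $\mathsf T$ and on the fixed data (including $u$, $u^0$, $\alpha$, $\beta$, $C$, $q$), but not on $\varepsilon$ or $m$.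
   Formalization: The condition that u(t,·) lies in X for all t in [0,T] is strengthened to: u(t,·) lies in X with the X-norm of u(t,·) bounded uniformly on [0,T]; with pointwise membership alone the estimate can fail. *)

(* Defs.v *)
From HB Require Import structures.
From mathcomp Require Import all_boot all_order all_algebra.
From mathcomp Require Import ring_quotient generic_quotient.
From mathcomp Require Import all_classical all_reals all_analysis.
From mathcomp Require Import measurable_realfun.
From mathcomp Require Import ring lra.
Set Implicit Arguments.
Unset Strict Implicit.
Unset Printing Implicit Defensive.
Import Order.TTheory GRing.Theory Num.Theory.
Import numFieldNormedType.Exports.
Local Open Scope classical_set_scope.
Local Open Scope ring_scope.

Section frobenius.
Context (R : realType) (m n : nat).
Implicit Types x y : 'M[R]_(m, n).

(* On column vectors [fdot] and [fnorm] are the Euclidean inner product and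
   norm; the norm that the library puts on matrices is the sup norm. *)
Definition fdot x y : R := \sum_i \sum_j x i j * y i j.
Definition fnorm x : R := Num.sqrt (fdot x x).

Lemma fdotC x y : fdot x y = fdot y x.
Proof. by apply: eq_bigr => i _; apply: eq_bigr => j _; rewrite mulrC. Qed.

Lemma fdotDl x y z : fdot (x + y) z = fdot x z + fdot y z.
Proof.
rewrite /fdot -big_split /=; apply: eq_bigr => i _; rewrite -big_split /=.
by apply: eq_bigr => j _; rewrite mxE mulrDl.
Qed.

Lemma fdotZl a x y : fdot (a *: x) y = a * fdot x y.
Proof.
rewrite /fdot big_distrr /=; apply: eq_bigr => i _; rewrite big_distrr /=.
by apply: eq_bigr => j _; rewrite mxE mulrA.
Qed.

Lemma fdotDr x y z : fdot x (y + z) = fdot x y + fdot x z.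
Proof. by rewrite fdotC fdotDl !(fdotC x). Qed.

Lemma fdotZr a x y : fdot x (a *: y) = a * fdot x y.
Proof. by rewrite fdotC fdotZl fdotC. Qed.

Lemma fdot_ge0 x : 0 <= fdot x x.
Proof. by apply: sumr_ge0 => i _; apply: sumr_ge0 => j _; rewrite -expr2 sqr_ge0. Qed.

Lemma fdot_eq0 x : fdot x x = 0 -> x = 0.
Proof.
move=> /eqP; rewrite psumr_eq0; last first.
  by move=> i _; apply: sumr_ge0 => j _; rewrite -expr2 sqr_ge0.
move=> /allP h; apply/matrixP => i j; rewrite mxE; apply/eqP.
have := h i (mem_index_enum _); rewrite /= psumr_eq0; last first.
  by move=> k _; rewrite -expr2 sqr_ge0.
by move=> /allP /(_ j (mem_index_enum _)) /=; rewrite mulf_eq0 orbb.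
Qed.

Lemma fdot0 : fdot 0 0 = 0.
Proof. by rewrite -(scale0r 0) fdotZl mul0r. Qed.

Lemma fnorm_sqr x : fnorm x ^+ 2 = fdot x x.
Proof. by rewrite sqr_sqrtr// fdot_ge0. Qed.

Lemma fnorm_ge0 x : 0 <= fnorm x.
Proof. exact: sqrtr_ge0. Qed.

Lemma fdot_CS x y : fdot x y <= fnorm x * fnorm y.
Proof.
have [x0|x0] := eqVneq (fnorm x) 0.
  have -> : x = 0 by apply: fdot_eq0; rewrite -fnorm_sqr x0 expr0n.
  by rewrite -(scale0r 0) fdotZl mul0r mulr_ge0 ?fnorm_ge0.
have [y0|y0] := eqVneq (fnorm y) 0.
  have -> : y = 0 by apply: fdot_eq0; rewrite -fnorm_sqr y0 expr0n.
  by rewrite -(scale0r 0) fdotZr mul0r mulr_ge0 ?fnorm_ge0.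
have xp : 0 < fnorm x by rewrite lt_neqAle eq_sym x0 fnorm_ge0.
have yp : 0 < fnorm y by rewrite lt_neqAle eq_sym y0 fnorm_ge0.
have := fdot_ge0 (fnorm y *: x - fnorm x *: y).
rewrite -scaleNr !(fdotDl, fdotDr, fdotZl, fdotZr) (fdotC y x) -!fnorm_sqr.
move=> h; rewrite -subr_ge0 -(pmulr_rge0 _ xp) -(pmulr_rge0 _ yp).
rewrite -(pmulr_rge0 _ (ltr0n R 2)).
apply: le_trans h _; rewrite le_eqVlt; apply/orP; left; apply/eqP.
by ring.
Qed.

Lemma fnormD x y : fnorm (x + y) <= fnorm x + fnorm y.
Proof.
rewrite -(@ler_pXn2r _ 2)// ?nnegrE ?addr_ge0 ?fnorm_ge0//.
rewrite fnorm_sqr fdotDl !fdotDr (fdotC y x) sqrrD -!fnorm_sqr.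
rewrite addrA -(addrA (fnorm x ^+ 2)) lerD2r lerD2l mulr2n.
by rewrite lerD ?fdot_CS.
Qed.

Lemma fnormZ a x : fnorm (a *: x) = `|a| * fnorm x.
Proof.
by rewrite /fnorm fdotZl fdotZr mulrA -expr2 sqrtrM ?sqr_ge0// sqrtr_sqr.
Qed.

End frobenius.

Section square_integrable.
Context d (T : measurableType d) (R : realType).
Variables (mu : {measure set T -> \bar R}) (m n : nat).
Implicit Types f g : T -> 'M[R]_(m, n).

Definition sq_integrable f :=
  (forall i j, measurable_fun [set: T] (fun x => f x i j)) /\
  (\int[mu]_x ((fnorm (f x)) ^+ 2)%:E < +oo)%E.

Lemma measurable_fdot f g :
  (forall i j, measurable_fun [set: T] (fun x => f x i j)) ->
  (forall i j, measurable_fun [set: T] (fun x => g x i j)) ->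
  measurable_fun [set: T] (fun x => fdot (f x) (g x)).
Proof.
move=> mf mg; apply: measurable_sum => i; apply: measurable_sum => j.
exact: measurable_funM.
Qed.

Lemma sqi_integrable f : sq_integrable f ->
  mu.-integrable setT (EFin \o (fun x => fdot (f x) (f x))).
Proof.
move=> [mf fi]; apply/integrableP; split.
  by apply/measurable_EFinP; exact: measurable_fdot.
apply: le_lt_trans fi; rewrite le_eqVlt; apply/orP; left; apply/eqP.
apply: eq_integral => x _.
by rewrite fnorm_sqr /= ger0_norm// fdot_ge0.
Qed.

Lemma fdot_le x y : `|@fdot R m n x y| <= fdot x x + fdot y y.
Proof.
have h1 := fdot_ge0 (x + y); have h2 := fdot_ge0 (x + (-1) *: y).
rewrite !(fdotDl, fdotDr, fdotZl, fdotZr) (fdotC y x) in h1 h2.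
have := fdot_ge0 x; have := fdot_ge0 y.
by move=> ? ?; rewrite ler_norml; apply/andP; split; lra.
Qed.

Lemma fdot_integrable f g : sq_integrable f -> sq_integrable g ->
  mu.-integrable setT (EFin \o (fun x => fdot (f x) (g x))).
Proof.
move=> fi gi.
have h := integrableD measurableT (sqi_integrable fi) (sqi_integrable gi).
apply: le_integrable h => //.
  by apply/measurable_EFinP; exact: measurable_fdot fi.1 gi.1.
move=> x _ /=; rewrite lee_fin.
rewrite (le_trans (fdot_le _ _))// ler_norm//.
Qed.

Lemma sqiP f : (forall i j, measurable_fun [set: T] (fun x => f x i j)) ->
  mu.-integrable setT (EFin \o (fun x => fdot (f x) (f x))) -> sq_integrable f.
Proof.
move=> mf /integrableP[_ fi]; split=> //.
apply: le_lt_trans fi; rewrite le_eqVlt; apply/orP; left; apply/eqP.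
apply: eq_integral => x _.
by rewrite fnorm_sqr /= ger0_norm// fdot_ge0.
Qed.

Lemma sqi_lin (a : R) f g : sq_integrable f -> sq_integrable g ->
  sq_integrable (a *: f + g).
Proof.
move=> fi gi; apply: sqiP.
  move=> i j; rewrite (_ : (fun x => _) = (fun x => a * f x i j + g x i j)).
    apply: measurable_funD; last exact: gi.1.
    by apply: measurable_funM => //; exact: fi.1.
  by apply/funext => x; rewrite !mxE.
rewrite (_ : _ \o _ = (fun x => (a ^+ 2)%:E * (fdot (f x) (f x))%:E +
   ((2 * a)%:E * (fdot (f x) (g x))%:E + (fdot (g x) (g x))%:E))%E).
  apply: integrableD => //; first by apply: integrableZl => //; exact: sqi_integrable.
  apply: integrableD => //; last exact: sqi_integrable.
  by apply: integrableZl => //; exact: fdot_integrable.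
apply/funext => x /=; rewrite -!EFinM -!EFinD; congr EFin.
rewrite [X in fdot X](_ : _ = a *: f x + g x)// !(fdotDl, fdotDr, fdotZl, fdotZr).
rewrite (fdotC (g x)); ring.
Qed.

Definition sqi_pred : {pred T -> 'M[R]_(m, n)} := mem [set f | sq_integrable f].

Lemma sqi_predE f : (f \in sqi_pred) = `[< sq_integrable f >].
Proof. by apply/idP/asboolP; rewrite /sqi_pred !inE. Qed.

Lemma sqi0 : sq_integrable 0.
Proof.
apply: sqiP.
  move=> i j; rewrite (_ : (fun x => _) = cst 0)//.
  by apply/funext => x; rewrite mxE.
rewrite (_ : _ \o _ = cst 0%E); first exact: integrable0.
by apply/funext => x /=; rewrite [X in fdot X](_ : _ = 0)// fdot0.
Qed.

Lemma sqi_submod_closed : submod_closed sqi_pred.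
Proof.
split; first by rewrite sqi_predE; apply/asboolP; exact: sqi0.
move=> a f g; rewrite !sqi_predE => /asboolP fi /asboolP gi.
by apply/asboolP; exact: sqi_lin.
Qed.

HB.instance Definition _ :=
  GRing.isSubmodClosed.Build _ _ sqi_pred sqi_submod_closed.

Record sqfun := SqFun { sqfun_val :> T -> 'M[R]_(m, n); _ : sqfun_val \in sqi_pred }.
HB.instance Definition _ := [isSub for sqfun_val].
HB.instance Definition _ := [Choice of sqfun by <:].
HB.instance Definition _ := [SubChoice_isSubLmodule of sqfun by <:].

Definition ae0_pred : {pred sqfun} :=
  mem [set f : sqfun | {ae mu, forall x, f x = 0}].

Lemma ae0_predE (f : sqfun) : (f \in ae0_pred) = `[< {ae mu, forall x, f x = 0} >].
Proof. by apply/idP/asboolP; rewrite /ae0_pred !inE. Qed.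

Lemma ae0_zmod_closed : zmod_closed ae0_pred.
Proof.
split; first by rewrite ae0_predE; apply/asboolP; exact: aeW.
move=> f g; rewrite !ae0_predE => /asboolP f0 /asboolP g0; apply/asboolP.
apply: filterS2 f0 g0 => x /= fx gx.
by rewrite [LHS](_ : _ = f x - g x)// fx gx subrr.
Qed.

HB.instance Definition _ := GRing.isZmodClosed.Build _ ae0_pred ae0_zmod_closed.

(* L^2(T, mu; R^(m x n)): square-integrable functions modulo a.e. equality. *)
Definition L2 : Type := Quotient.quot ae0_pred.
HB.instance Definition _ := Choice.on L2.
HB.instance Definition _ := GRing.Zmodule.on L2.
HB.instance Definition _ := EqQuotient.on L2.

Local Open Scope quotient_scope.

Definition L2_fun (v : L2) : T -> 'M[R]_(m, n) := sqfun_val (repr v).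

Definition L2_pi (f : sqfun) : L2 := \pi_L2 f.

(* the class of f, or 0 if f is not square integrable *)
Definition toL2 f : L2 :=
  match pselect (f \in sqi_pred) with
  | left h => L2_pi (SqFun h)
  | right _ => 0
  end.

Lemma L2_piP (f g : sqfun) :
  L2_pi f = L2_pi g <-> {ae mu, forall x, f x = g x}.
Proof.
split.
  move/eqP; rewrite /L2_pi -Quotient.idealrBE ae0_predE => /asboolP.
  apply: filterS => x /= /eqP.
  by rewrite [X in X == _ -> _](_ : _ = f x - g x)// subr_eq0 => /eqP.
move=> fg; apply/eqP; rewrite /L2_pi -Quotient.idealrBE ae0_predE; apply/asboolP.
apply: filterS fg => x /= h.
by rewrite [LHS](_ : _ = f x - g x)// h subrr.
Qed.

Lemma L2_funK (v : L2) : toL2 (L2_fun v) = v.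
Proof.
rewrite /toL2; case: pselect => [h|]; last by case; exact: (valP (repr v)).
rewrite -[RHS]reprK; congr (\pi_L2 _); exact: val_inj.
Qed.

Lemma L2_fun_sqi (v : L2) : sq_integrable (L2_fun v).
Proof. by have := valP (repr v); rewrite sqi_predE => /asboolP. Qed.

Lemma toL2K f : sq_integrable f -> {ae mu, forall x, L2_fun (toL2 f) x = f x}.
Proof.
move=> fi; rewrite /toL2; case: pselect => [h|]; last first.
  by case; rewrite sqi_predE; exact/asboolP.
rewrite /L2_fun; suff /L2_piP : L2_pi (repr (L2_pi (SqFun h))) = L2_pi (SqFun h) by [].
exact: reprK.
Qed.

Lemma L2_fun_pi (f : sqfun) : {ae mu, forall x, L2_fun (L2_pi f) x = f x}.
Proof. by apply/L2_piP; exact: reprK. Qed.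

Lemma L2_eqP (u v : L2) : u = v <-> {ae mu, forall x, L2_fun u x = L2_fun v x}.
Proof.
rewrite -L2_piP; split=> [-> //|]; by rewrite /L2_pi !reprK.
Qed.

Definition L2_scale (a : R) (v : L2) : L2 := L2_pi (a *: repr v).

Lemma L2_piD (f g : sqfun) : L2_pi (f + g) = L2_pi f + L2_pi g.
Proof. by rewrite /L2_pi; exact: (@Quotient.pi_add _ ae0_pred). Qed.

Lemma L2_piZ a (f : sqfun) : L2_pi (a *: f) = L2_scale a (L2_pi f).
Proof.
apply/L2_piP; have := L2_fun_pi f; apply: filterS => x h /=.
by rewrite [LHS](_ : _ = a *: f x)// [RHS](_ : _ = a *: L2_fun (L2_pi f) x)// h.
Qed.

Lemma L2_piK (v : L2) : L2_pi (repr v) = v. Proof. exact: reprK. Qed.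

Lemma L2_scalerA a b v : L2_scale a (L2_scale b v) = L2_scale (a * b) v.
Proof. by rewrite -[v]L2_piK -!L2_piZ scalerA. Qed.

Lemma L2_scale1r : left_id 1 L2_scale.
Proof. by move=> v; rewrite -[v]L2_piK -!L2_piZ scale1r. Qed.

Lemma L2_scalerDr : right_distributive L2_scale +%R.
Proof.
by move=> a u v; rewrite -[u]L2_piK -[v]L2_piK -!(L2_piD, L2_piZ) scalerDr.
Qed.

Lemma L2_scalerDl v : {morph L2_scale^~ v : a b / a + b}.
Proof.
by move=> a b /=; rewrite -[v]L2_piK -!(L2_piD, L2_piZ) scalerDl.
Qed.

HB.instance Definition _ := GRing.Zmodule_isLmodule.Build R L2
  L2_scalerA L2_scale1r L2_scalerDr L2_scalerDl.

Lemma L2_funD (u v : L2) :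
  {ae mu, forall x, L2_fun (u + v) x = L2_fun u x + L2_fun v x}.
Proof.
by have := L2_fun_pi (repr u + repr v); rewrite L2_piD !L2_piK.
Qed.

Lemma L2_funZ a (v : L2) : {ae mu, forall x, L2_fun (a *: v) x = a *: L2_fun v x}.
Proof. by have := L2_fun_pi (a *: repr v); rewrite L2_piZ !L2_piK. Qed.

Lemma L2_fun0 : {ae mu, forall x, L2_fun 0 x = 0}.
Proof. by have := L2_funZ 0 0; rewrite scale0r; apply: filterS => x ->; rewrite scale0r. Qed.

Definition L2_dot (u v : L2) : R := \int[mu]_x fdot (L2_fun u x) (L2_fun v x).

Definition L2_norm (v : L2) : R := Num.sqrt (\int[mu]_x (fnorm (L2_fun v x)) ^+ 2).

Lemma L2_normE v : L2_norm v = Num.sqrt (L2_dot v v).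
Proof. by congr Num.sqrt; apply: eq_Rintegral => x _; rewrite fnorm_sqr. Qed.

Lemma L2_dotC u v : L2_dot u v = L2_dot v u.
Proof. by apply: eq_Rintegral => x _; rewrite fdotC. Qed.

Lemma L2_dot_integrable u v :
  mu.-integrable setT (EFin \o (fun x => fdot (L2_fun u x) (L2_fun v x))).
Proof. by apply: fdot_integrable; exact: L2_fun_sqi. Qed.

Lemma ae_eq_Rint (f g : T -> R) : measurable_fun setT f -> measurable_fun setT g ->
  {ae mu, forall x, f x = g x} -> \int[mu]_x f x = \int[mu]_x g x.
Proof.
move=> mf mg fg; rewrite /Rintegral; congr fine.
apply: ae_eq_integral => //; [exact/measurable_EFinP|exact/measurable_EFinP|].
by apply: filterS fg => x /= ->.
Qed.

Lemma L2_dotDl u v w : L2_dot (u + v) w = L2_dot u w + L2_dot v w.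
Proof.
rewrite -RintegralD//; try exact: L2_dot_integrable.
have ms (z : L2) := (L2_fun_sqi z).1.
apply: ae_eq_Rint; [exact: measurable_fdot|..].
  by apply: measurable_funD; exact: measurable_fdot.
by have := L2_funD u v; apply: filterS => x ->; rewrite fdotDl.
Qed.

Lemma L2_dotZl a u w : L2_dot (a *: u) w = a * L2_dot u w.
Proof.
rewrite -RintegralZl//; try exact: L2_dot_integrable.
have ms (z : L2) := (L2_fun_sqi z).1.
apply: ae_eq_Rint; [exact: measurable_fdot|..].
  by apply: measurable_funM => //; exact: measurable_fdot.
by have := L2_funZ a u; apply: filterS => x ->; rewrite fdotZl.
Qed.

Lemma L2_dotDr u v w : L2_dot u (v + w) = L2_dot u v + L2_dot u w.
Proof. by rewrite L2_dotC L2_dotDl !(L2_dotC u). Qed.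

Lemma L2_dotZr a u w : L2_dot u (a *: w) = a * L2_dot u w.
Proof. by rewrite L2_dotC L2_dotZl L2_dotC. Qed.

Lemma L2_dot_ge0 u : 0 <= L2_dot u u.
Proof. by apply: Rintegral_ge0 => x _; exact: fdot_ge0. Qed.

Lemma L2_dot_eq0 u : L2_dot u u = 0 -> u = 0.
Proof.
move=> h; apply/L2_eqP.
have ms (z : L2) := (L2_fun_sqi z).1.
have : (\int[mu]_x `|(fdot (L2_fun u x) (L2_fun u x))%:E| = 0)%E.
  under eq_integral do rewrite gee0_abs ?lee_fin ?fdot_ge0//.
  rewrite -[LHS]fineK; last exact: integrable_fin_num (L2_dot_integrable u u).
  by congr EFin; exact: h.
move/ae_eq_integral_abs => h0.
have {}h0 := h0 measurableT _.
have /h0 : measurable_fun setT (fun x => (fdot (L2_fun u x) (L2_fun u x))%:E).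
  by apply/measurable_EFinP; exact: measurable_fdot.
apply: filterS2 L2_fun0 => x -> /(_ I) /= [] /fdot_eq0; exact.
Qed.

Lemma L2_norm0_eq0 v : L2_norm v = 0 -> v = 0.
Proof.
rewrite L2_normE => /eqP; rewrite sqrtr_eq0 => h; apply: L2_dot_eq0.
by apply/eqP; rewrite eq_le h L2_dot_ge0.
Qed.

Lemma L2_norm_sqr v : L2_norm v ^+ 2 = L2_dot v v.
Proof. by rewrite L2_normE sqr_sqrtr// L2_dot_ge0. Qed.

Lemma L2_norm_ge0 v : 0 <= L2_norm v.
Proof. exact: sqrtr_ge0. Qed.

Lemma L2_dot0l v : L2_dot 0 v = 0.
Proof. by rewrite -(scale0r 0) L2_dotZl mul0r. Qed.

Lemma L2_dot_CS x y : L2_dot x y <= L2_norm x * L2_norm y.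
Proof.
have [x0|x0] := eqVneq (L2_norm x) 0.
  by rewrite (L2_norm0_eq0 x0) L2_dot0l mulr_ge0 ?L2_norm_ge0.
have [y0|y0] := eqVneq (L2_norm y) 0.
  by rewrite (L2_norm0_eq0 y0) L2_dotC L2_dot0l mulr_ge0 ?L2_norm_ge0.
have xp : 0 < L2_norm x by rewrite lt_neqAle eq_sym x0 L2_norm_ge0.
have yp : 0 < L2_norm y by rewrite lt_neqAle eq_sym y0 L2_norm_ge0.
have := L2_dot_ge0 (L2_norm y *: x - L2_norm x *: y).
rewrite -scaleNr !(L2_dotDl, L2_dotDr, L2_dotZl, L2_dotZr) (L2_dotC y x).
rewrite -!L2_norm_sqr.
move=> h; rewrite -subr_ge0 -(pmulr_rge0 _ xp) -(pmulr_rge0 _ yp).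
rewrite -(pmulr_rge0 _ (ltr0n R 2)).
apply: le_trans h _; rewrite le_eqVlt; apply/orP; left; apply/eqP.
by ring.
Qed.

Lemma L2_normD x y : L2_norm (x + y) <= L2_norm x + L2_norm y.
Proof.
rewrite -(@ler_pXn2r _ 2)// ?nnegrE ?addr_ge0 ?L2_norm_ge0//.
rewrite L2_norm_sqr L2_dotDl !L2_dotDr (L2_dotC y x) sqrrD -!L2_norm_sqr.
by have := L2_dot_CS x y; rewrite mulr2n; lra.
Qed.

Lemma L2_normZ a x : L2_norm (a *: x) = `|a| * L2_norm x.
Proof.
by rewrite !L2_normE L2_dotZl L2_dotZr mulrA -expr2 sqrtrM ?sqr_ge0// sqrtr_sqr.
Qed.

HB.instance Definition _ := Lmodule_isNormed.Build R L2
  L2_normD L2_normZ L2_norm0_eq0.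

End square_integrable.

Arguments toL2 {d T R} mu {m n} f.

Section L2_operators.
Context (R : realType).

Definition integral_operator d (T : measurableType d)
    (mu : {measure set T -> \bar R}) p (s : T * T -> 'M[R]_p)
    (v : L2 mu p 1) : L2 mu p 1 :=
  toL2 mu (fun x => \col_i \int[mu]_y (s (x, y) *m L2_fun v y) i 0).

(* v |-> v \o phi, where phi only matters on the full-measure set D *)
Definition L2_comp d1 d2 (T1 : measurableType d1) (T2 : measurableType d2)
    (mu1 : {measure set T1 -> \bar R}) (mu2 : {measure set T2 -> \bar R}) p
    (D : set T1) (phi : T1 -> T2) (v : L2 mu2 p 1) : L2 mu1 p 1 :=
  toL2 mu1 (fun x => if x \in D then L2_fun v (phi x) else 0).

Definition orthogonal_projection d (T : measurableType d)
    (mu : {measure set T -> \bar R}) p (W : set (L2 mu p 1))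
    (v : L2 mu p 1) : L2 mu p 1 :=
  xget 0 [set g | W g /\ forall h, W h -> L2_dot (v - g) h = 0].

End L2_operators.

Arguments integral_operator {R d T} mu {p} s v.

Section semigroups.
Context (R : realType) (V : normedModType R).
Implicit Types (S : R -> V -> V) (D E : set V) (A B : V -> V).

Record C0_semigroup S : Prop := {
  C0_linear : forall t, 0 <= t -> linear (S t);
  C0_bounded : forall t, 0 <= t -> continuous (S t);
  C0_0 : forall v, S 0 v = v;
  C0_add : forall s t v, 0 <= s -> 0 <= t -> S (s + t) v = S s (S t v);
  C0_strong : forall v, S t v @[t --> 0^'+] --> v }.

(* the operator A with domain D; the values of A outside D are irrelevant *)
Definition generates D A S := forall v w,
  (D v /\ A v = w) <-> (h^-1 *: (S h v - v) @[h --> 0^'+] --> w).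

Definition subspace_set D :=
  [/\ D 0, forall v w, D v -> D w -> D (v + w) & forall a v, D v -> D (a *: v)].

Definition linear_on D A :=
  (forall v w, D v -> D w -> A (v + w) = A v + A w) /\
  (forall a v, D v -> A (a *: v) = a *: A v).

Definition core D A E :=
  [/\ subspace_set E, E `<=` D & forall v, D v -> forall e, 0 < e ->
     exists w, [/\ E w, `|v - w| < e & `|A v - A w| < e]].

Definition uniformly_stable (Ae : R -> V -> V) :=
  exists M omega : R, 1 <= M /\ forall eps, 0 < eps ->
    exists S, [/\ C0_semigroup S, generates setT (Ae eps) S &
      forall t v, 0 <= t -> `|S t v| <= M * expR (omega * t) * `|v|].

Definition mild_solution S (v0 : V) (t : R) : V := S t v0.

(* Continuity on ]0, +oo[ follows from differentiability. *)
Definition cauchy_solution B (v0 : V) (v : R -> V) :=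
  [/\ v 0 = v0, v t @[t --> 0^'+] --> v0 &
      forall t : R, 0 < t -> is_derive t 1 v (B (v t))].

(* The norm of C([0, tau]; V), extended-real valued so that an unbounded
   function gets +oo. *)
Definition C_norm (tau : R) (v : R -> V) : \bar R :=
  ereal_sup [set (`|v t|)%:E | t in `[0, tau]].

End semigroups.

Section coding.
Context (k : nat).

(* Sequences over a k-letter alphabet; the phantom argument makes the type
   inhabited, as the library requires of measurable types. *)
Definition sequences (hk : (1 < k)%N) : Type := nat -> 'I_k.

Context (hk : (1 < k)%N).
HB.instance Definition _ := gen_eqMixin (sequences hk).
HB.instance Definition _ := gen_choiceMixin (sequences hk).
HB.instance Definition _ :=
  isPointed.Build (sequences hk) (fun=> Ordinal (ltnW hk)).

Definition cylinder m (w : m.-tuple 'I_k) : set (sequences hk) :=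
  [set s | forall i : 'I_m, s i = tnth w i].

Definition cylinders : set (set (sequences hk)) :=
  [set C | exists m (w : m.-tuple 'I_k), C = cylinder w].

Definition Sigma := g_sigma_algebraType cylinders.

Definition uniform_bernoulli (R : realType) (mu : set Sigma -> \bar R) :=
  forall m (w : m.-tuple 'I_k), mu (cylinder w) = ((k%:R ^+ m)^-1)%:E.

Context (T : pointedType) (f : 'I_k -> T -> T) (K : set T).

Definition word_map (w : seq 'I_k) : T -> T :=
  foldr (fun i g => f i \o g) id w.

Definition cell (w : seq 'I_k) : set T := word_map w @` K.

Definition natural_projection (s : nat -> 'I_k) : T :=
  get (\bigcap_(n in [set n | (0 < n)%N]) cell (mkseq s n)).

Definition overlap_set : set (nat -> 'I_k) :=
  [set s | exists2 s', s' <> s & natural_projection s' = natural_projection s].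

End coding.

Section ifs.
Context (R : realType) (k d : nat).

Definition similitude (q : R) (f : 'cV[R]_d -> 'cV[R]_d) :=
  forall x y, fnorm (f x - f y) = q * fnorm (x - y).

Definition attractor (f : 'I_k -> 'cV[R]_d -> 'cV[R]_d) (K : set 'cV[R]_d) :=
  [/\ K !=set0, compact K & K = \bigcup_i (f i @` K)].

Definition borel_space := g_sigma_algebraType (@open 'cV[R]_d).

(* The letters 1, ..., k are numbered from 0. *)
Definition interval_map (i : 'I_k) (x : R) : R := x / k%:R + i%:R / k%:R.

Definition unit_itv : set R := `[0, 1].

End ifs.

Arguments unit_itv {R}.

(* A measure on R for which the complement of [0, 1] is null: functions on R
   modulo a.e. equality stand for functions on [0, 1]. *)
Definition unit_lebesgue (R : realType) :=
  mrestr (@lebesgue_measure R) (measurable_itv `[0, 1] : measurable unit_itv).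
Arguments unit_lebesgue R _ : clear implicits.
HB.instance Definition _ (R : realType) := Measure.on (@unit_lebesgue R).

Lemma unit_lebesgue_fin (R : realType) : fin_num_fun (@unit_lebesgue R).
Proof.
move=> U mU; rewrite /unit_lebesgue /mrestr ge0_fin_numE ?measure_ge0//.
apply: (@le_lt_trans _ _ (lebesgue_measure (`[0, 1] : set R))).
  apply: le_measure; [| |exact: subIsetr]; apply: mem_set => //.
  by apply: measurableI => //; exact: measurable_itv.
by rewrite lebesgue_measure_itv /= lte_fin ltr01 oppr0 adde0 ltry.
Qed.
HB.instance Definition _ (R : realType) :=
  Measure_isFinite.Build _ _ _ (@unit_lebesgue R) (@unit_lebesgue_fin R).

Notation L2Q R p := (L2 (unit_lebesgue R) p 1).

Section transport.
Context d1 d2 (T1 : measurableType d1) (T2 : measurableType d2) (R : realType).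
Variables (lam : {measure set T1 -> \bar R}) (nu : {measure set T2 -> \bar R}).

(* Psi stands for the inverse of Phi; the values of Phi and Psi outside Q0 and
   K0 are irrelevant. *)
Record mp_bijection (Q : set T1) (K : set T2) (Q0 : set T1) (K0 : set T2)
    (Phi : T1 -> T2) (Psi : T2 -> T1) : Prop := {
  mpb_mQ0 : measurable Q0;
  mpb_mK0 : measurable K0;
  mpb_subQ : Q0 `<=` Q;
  mpb_subK : K0 `<=` K;
  mpb_fullQ : lam (~` Q0) = 0%E;
  mpb_fullK : nu (~` K0) = 0%E;
  mpb_Phi : forall x, Q0 x -> K0 (Phi x);
  mpb_Psi : forall y, K0 y -> Q0 (Psi y);
  mpb_PhiK : forall x, Q0 x -> Psi (Phi x) = x;
  mpb_PsiK : forall y, K0 y -> Phi (Psi y) = y;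
  mpb_mPhi : measurable_fun Q0 Phi;
  mpb_mPsi : measurable_fun K0 Psi;
  mpb_preserving : forall B, measurable B -> B `<=` K0 ->
    lam (Q0 `&` Phi @^-1` B) = nu B }.

Definition lifted_kernel p (K0 : set T2) (Psi : T2 -> T1)
    (s : T1 * T1 -> 'M[R]_p) (z : T2 * T2) : 'M[R]_p :=
  if z \in K0 `*` K0 then s (Psi z.1, Psi z.2) else 0.

End transport.

Section discretization.
Context (R : realType) (k d p : nat).
Variables (f : 'I_k -> 'cV[R]_d -> 'cV[R]_d) (K : set 'cV[R]_d).
Variable nu : probability (borel_space R d) R.
Let Kw (w : seq 'I_k) : set (borel_space R d) := cell f K w.

Definition step_space m : set (L2 nu p 1) :=
  [set g | exists c : m.-tuple 'I_k -> 'cV[R]_p,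
     g = toL2 nu (fun x => \sum_(w : m.-tuple 'I_k) \1_(Kw w) x *: c w)].

Definition step_projection m : L2 nu p 1 -> L2 nu p 1 :=
  orthogonal_projection (@step_space m).

Definition cell_average (s : borel_space R d * borel_space R d -> 'M[R]_p)
    (w v : seq 'I_k) : 'M[R]_p :=
  \matrix_(i, j) ((fine ((nu \x nu)%E (Kw w `*` Kw v)))^-1 *
                  \int[(nu \x nu)%E]_(z in Kw w `*` Kw v) s z i j).

Definition step_kernel m (s : borel_space R d * borel_space R d -> 'M[R]_p)
    (z : borel_space R d * borel_space R d) : 'M[R]_p :=
  \sum_(w : m.-tuple 'I_k) \sum_(v : m.-tuple 'I_k)
    \1_(Kw w `*` Kw v) z *: cell_average s w v.

End discretization.

Definition asymp (R : realType) (a b : nat -> R) :=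
  exists c1 c2, [/\ 0 < c1, 0 < c2 & forall n, c1 <= a n / b n <= c2].

(* Main.v *)
(** The error [T u_{eps,m} - u] lives in L^2(Q); its right derivative is [A_eps]
    applied to it, plus the discretization error of the kernel (bounded by the
    Hilbert-Schmidt norm) and the consistency error [(A_eps - A) u].  In the
    equivalent norm [sup_t exp(-w t) |S_eps(t) v|] the semigroup of [A_eps] is
    quasi-contractive, so a one-sided Gronwall inequality, uniform in [eps] and
    [m], bounds the error.  Consistency is only assumed on a dense subspace of
    [X]; it extends to [X] because [A] is bounded from [X] to L^2(Q), which
    follows from the uniform boundedness of the reference semigroup near 0
    (Banach-Steinhaus, whence the need for the completeness of L^2). *)
From HB Require Import structures.
Require Import Defs.
From mathcomp Require Import all_boot all_order all_algebra.
From mathcomp Require Import all_classical all_reals all_analysis.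
From mathcomp Require Import measurable_realfun ring lra.
Set Implicit Arguments.
Unset Strict Implicit.
Unset Printing Implicit Defensive.
Import Order.TTheory GRing.Theory Num.Theory.
Import numFieldNormedType.Exports.
Local Open Scope classical_set_scope.
Local Open Scope ring_scope.

(** * One-sided Gronwall inequality and perturbed semigroups *)

(** The error is driven by [A_eps] rather than by the discretized operator for two reasons: (A1)
    controls the semigroups of [A_eps] only, and consistency can be applied to [u], which stays in
    [X], but not to the discrete solution, which need not. The kernel error therefore acts on
    [T u_{eps,m} = e + u]: its action on [e] is absorbed into the Gronwall exponent, its action on
    [u] is a source term. The exponent is uniform in [m] because the Hilbert-Schmidt norm of the
    kernel error is at most [C q^(alpha m) <= C]. To bound [A] on [X], (A2) at any single [eps] is
    enough, since [A] does not depend on [eps]. The bound cannot pass from the dense subspace to [X]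
    through [A] itself, which may be unbounded on L^2(Q); it passes through the increments
    [S_h v - v], which are continuous in [v]. *)

(** A barrier argument: let [c] be the last time up to which [g] stays below an exponential [G].
    Left continuity keeps [g c <= G c], and the differential inequality carries the bound past [c],
    so [c = tau]. The extra 1 in the exponent pays for the source term, because [b + eta <= G c]. *)
Lemma right_gronwall (R : realType) (g : R -> R) (tau w a b : R) :
  0 <= w -> 0 <= a -> 0 <= b -> 0 <= g 0 ->
  g t @[t --> 0^'+] --> g 0 ->
  (forall t, 0 < t <= tau -> g s @[s --> t^'-] --> g t) ->
  (forall t eta, 0 < t < tau -> 0 < eta -> \forall h \near 0^'+,
     g (t + h) <= expR (w * h) * g t + h * (a * g t + b + eta)) ->
  forall t, 0 <= t <= tau -> g t <= (g 0 + b) * expR ((w + a + 1) * t).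
Proof.
move=> w0 a0 b0 g0 gr gl gd.
(* The slack [eta] lets [g] start strictly below the barrier; it tends to 0 at the end. *)
suff key eta : 0 < eta -> forall t, 0 <= t <= tau ->
    g t <= (g 0 + b + eta) * expR ((w + a + 1) * t).
  move=> t t0; apply/ler_addgt0Pr => eps eps0.
  have E0 := expR_gt0 ((w + a + 1) * t).
  have := key (eps / expR ((w + a + 1) * t)) (divr_gt0 eps0 E0) t t0.
  by rewrite mulrDl divfK ?gt_eqF.
move=> eta0; set kap := g 0 + b + eta; set G := fun t => kap * expR ((w + a + 1) * t).
have kap0 : 0 < kap by rewrite /kap; lra.
have Ghom s t : s <= t -> G s <= G t.
  move=> st; rewrite ler_pM2l// ler_expR ler_wpM2l//; lra.
have G0 : G 0 = kap by rewrite /G mulr0 expR0 mulr1.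
pose E := [set t | 0 <= t <= tau /\ forall s, 0 <= s <= t -> g s <= G s].
move=> t0 /andP[t00 t0tau].
have tau0 : 0 <= tau by lra.
have E0 : E 0.
  split; first by rewrite lexx tau0.
  move=> s /andP[s0 s1]; have -> : s = 0 by lra.
  by rewrite G0 /kap; lra.
have hsE : has_sup E.
  by split; [exists 0|exists tau => x [/andP[]]].
set c := sup E.
have c0 : 0 <= c by apply: ub_le_sup => //; case: hsE.
have ctau : c <= tau.
  by apply: ge_sup; [exists 0|move=> x [/andP[]]].
have below s : 0 <= s -> s < c -> g s <= G s.
  move=> s0 sc; have [x [_ Ex] sx] := @sup_adherent _ E (c - s) ltac:(lra) hsE.
  by apply: Ex; rewrite s0 /=; move: sx; rewrite -/c; lra.
have gc : g c <= G c.
  have [c00|cN0] := eqVneq c 0; first by rewrite c00 G0 /kap; lra.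
  have cp : 0 < c by rewrite lt_neqAle eq_sym cN0.
  apply: (cvgr_to_le (gl c _)); first by rewrite cp ctau.
  near=> s; apply: (@le_trans _ _ (G s)).
    apply: below; last by near: s; exact: nbhs_left_lt.
    by near: s; exact: nbhs_left_ge.
  by apply: Ghom; near: s; exact: nbhs_left_le.
have Ec : E c.
  split; first by rewrite c0.
  move=> s /andP[s0]; rewrite le_eqVlt => /predU1P[->//|]; exact: below.
suff cE : c = tau.
  by have [_] := Ec; apply; rewrite t00 cE.
apply/eqP; rewrite eq_le ctau /= leNgt; apply/negP => cltau.
have : \forall h \near 0^'+, g (c + h) <= G (c + h).
  (* The differential inequality holds at positive times only. At [c = 0] its role is taken by right
     continuity together with the strict inequality [g 0 < kap]. *)
  have [c00|cN0] := eqVneq c 0.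
    near=> h; rewrite c00 add0r; apply: (@le_trans _ _ kap).
      by near: h; apply: (cvgr_le _ gr); rewrite /kap; lra.
    by rewrite -G0; apply: Ghom; near: h; exact: nbhs_right_ge.
  have cp : 0 < c by rewrite lt_neqAle eq_sym cN0.
  have := gd c eta; rewrite cp cltau eta0 => /(_ isT isT).
  apply: filter_app; near=> h => gch.
  have h0 : 0 < h by near: h; exact: nbhs_right_gt.
  apply: (le_trans gch).
  have kG : kap <= G c by rewrite -G0; exact: Ghom.
  have Gc0 : 0 < G c by exact: lt_le_trans kG.
  have E1 : 1 <= expR (w * h) by rewrite -expR0 ler_expR mulr_ge0// ltW.
  have -> : G (c + h) = expR (w * h) * (G c * expR (h * (a + 1))).
    rewrite /G (_ : (w + a + 1) * (c + h) =
      w * h + (w + a + 1) * c + h * (a + 1)); last by ring.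
    by rewrite !expRD; ring.
  have le1 : G c + h * (a + 1) * G c <= G c * expR (h * (a + 1)).
    rewrite -[X in X + _]mul1r -mulrDl mulrC ler_pM2l//.
    exact: expR_ge1Dx.
  apply: (@le_trans _ _ (expR (w * h) * (G c + h * (a + 1) * G c))); last first.
    by rewrite ler_pM2l ?expR_gt0.
  rewrite [leRHS]mulrDr lerD// ?ler_pM2l ?expR_gt0//.
  apply: (@le_trans _ _ (h * (a + 1) * G c)); last first.
    by rewrite ler_peMl// mulr_ge0 ?mulr_ge0 ?(ltW h0) ?(ltW Gc0)//; lra.
  rewrite -mulrA ler_pM2l// mulrDl mul1r.
  have : a * g c <= a * G c by rewrite ler_wpM2l.
  rewrite /kap in kG; lra.
rewrite near_withinE near_simpl => /nbhs_ballP[e /= e0 He].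
pose h := Num.min (e / 2) (tau - c).
have hp : 0 < h by rewrite lt_min subr_gt0 cltau divr_gt0.
have he : h < e by rewrite gt_min; apply/orP; left; lra.
have htau : h <= tau - c by rewrite ge_min lexx orbT.
have : E (c + h).
  split; first lra.
  move=> s /andP[s0 sch]; have [sc|cs] := leP s c.
    by have [_] := Ec; apply; rewrite s0.
  have := He (s - c); rewrite /ball /= sub0r normrN => /(_ _ _).
  rewrite (addrC c) subrK; apply; last lra.
  by rewrite ger0_norm; lra.
move=> Ech; have : c + h <= c by apply: ub_le_sup => //; case: hsE.
lra.
Unshelve. all: by end_near. Qed.

Section stable_norm.
Context {R : realType} {V : normedModType R}.
Variables (S : R -> V -> V) (M w : R).
Hypothesis hS : C0_semigroup S.
Hypothesis stable : forall t v, 0 <= t -> `|S t v| <= M * expR (w * t) * `|v|.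

Let orbit_sizes v := [set expR (- (w * t)) * `|S t v| | t in [set t | 0 <= t]].

(** Feller's renorming: the constant [M] moves from the growth bound into the comparison of the two
    norms, where it is paid once and not at every time step. *)
Definition stable_norm v := sup (orbit_sizes v).

Let orbit_ub v : ubound (orbit_sizes v) (M * `|v|).
Proof.
move=> _ [t /= t0 <-].
apply: (le_trans (ler_wpM2l (expR_ge0 _) (stable v t0))).
by rewrite mulrA mulrCA -expRD addNr expR0 mulr1.
Qed.

Let orbit_sup v : has_sup (orbit_sizes v).
Proof.
split; last by exists (M * `|v|); exact: orbit_ub.
by exists (expR (- (w * 0)) * `|S 0 v|); exists 0 => //=.
Qed.

Let orbit_le v t : 0 <= t -> expR (- (w * t)) * `|S t v| <= stable_norm v.
Proof. by move=> t0; apply: ub_le_sup; [case: (orbit_sup v)|exists t]. Qed.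

Lemma le_stable_norm v : `|v| <= stable_norm v.
Proof. by have := orbit_le v (lexx 0); rewrite mulr0 oppr0 expR0 mul1r (C0_0 hS). Qed.

Lemma stable_norm_le v : stable_norm v <= M * `|v|.
Proof. by apply: ge_sup; [case: (orbit_sup v)|exact: orbit_ub]. Qed.

Lemma stable_normD u v : stable_norm (u + v) <= stable_norm u + stable_norm v.
Proof.
apply: ge_sup => [|_ [t /= t0 <-]]; first by case: (orbit_sup (u + v)).
have := C0_linear hS t0 1 u v; rewrite !scale1r => ->.
apply: le_trans (lerD (orbit_le u t0) (orbit_le v t0)).
by rewrite -mulrDr ler_wpM2l ?expR_ge0// ler_normD.
Qed.

(** The orbit of [S h v] is a tail of the orbit of [v], so only the weight changes. A factor [M > 1]
    here would not tend to 1 as [h] tends to 0 and would ruin the differential inequality. *)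
Lemma stable_norm_semigroup h v : 0 <= h ->
  stable_norm (S h v) <= expR (w * h) * stable_norm v.
Proof.
move=> h0; apply: ge_sup => [|_ [t /= t0 <-]]; first by case: (orbit_sup (S h v)).
rewrite -(C0_add hS)//.
apply: le_trans (ler_wpM2l (expR_ge0 _) (orbit_le v (addr_ge0 t0 h0))).
by rewrite mulrA -expRD (_ : w * h - _ = - (w * t))//; ring.
Qed.

Lemma stable_norm_dist u v : `|stable_norm u - stable_norm v| <= M * `|u - v|.
Proof.
have half x y : stable_norm x - stable_norm y <= M * `|x - y|.
  rewrite lerBlDr -{1}(subrK y x).
  by apply: le_trans (stable_normD _ _) _; rewrite lerD2r stable_norm_le.
rewrite ler_norml lerNl opprB (half u v) andbT.
by apply: le_trans (half v u) _; rewrite distrC.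
Qed.

Lemma cvg_stable_norm T (F : set_system T) {FF : Filter F} (e : T -> V) l :
  e x @[x --> F] --> l -> stable_norm (e x) @[x --> F] --> stable_norm l.
Proof.
move=> el.
have : M * `|e x - l| @[x --> F] --> M * 0.
  apply: cvgM; first exact: cvg_cst.
  rewrite -(normr0 V) -(subrr l); apply: cvg_norm.
  by apply: cvgB => //; exact: cvg_cst.
rewrite mulr0 => Me; apply/cvgrPdist_le => eps eps0.
have /cvgrPdist_le/(_ _ eps0) := Me; apply: filterS => x.
rewrite sub0r normrN => h; rewrite distrC.
by apply: le_trans (stable_norm_dist _ _) _; exact: le_trans (ler_norm _) h.
Qed.

End stable_norm.

(* In the norm [stable_norm] the semigroup is quasi-contractive, so Duhamel's
   formula is replaced by a one-sided differential inequality for the norm of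
   [e]. *)
Lemma perturbed_semigroup_bound (R : realType) (V : normedModType R)
    (S : R -> V -> V) (B : V -> V) (M w a b tau : R) (e e' : R -> V) :
  C0_semigroup S -> generates setT B S ->
  0 <= w -> 0 < M -> 0 <= a -> 0 <= b ->
  (forall t v, 0 <= t -> `|S t v| <= M * expR (w * t) * `|v|) ->
  e t @[t --> 0^'+] --> e 0 ->
  (forall t, 0 < t <= tau -> e s @[s --> t^'-] --> e t) ->
  (forall t, 0 < t < tau -> h^-1 *: (e (t + h) - e t) @[h --> 0^'+] --> e' t) ->
  (forall t, 0 < t < tau -> `|e' t - B (e t)| <= a * `|e t| + b) ->
  forall t, 0 <= t <= tau ->
    `|e t| <= (M * `|e 0| + M * b) * expR ((w + M * a + 1) * t).
Proof.
move=> hS gS w0 M0 a0 b0 stable er el ed eB t t0.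
pose N := stable_norm S w.
have leN v : `|v| <= N v by exact: (le_stable_norm hS stable).
have Nle v : N v <= M * `|v| by exact: (stable_norm_le stable).
apply: le_trans (leN _) _.
apply: (@le_trans _ _ ((N (e 0) + M * b) * expR ((w + M * a + 1) * t))); last first.
  by rewrite ler_wpM2r ?expR_ge0// lerD2r.
apply: (@right_gronwall R (N \o e) tau w (M * a) (M * b)) => //.
- by rewrite mulr_ge0// ltW.
- by rewrite mulr_ge0// ltW.
- by exact: le_trans (leN _).
- exact: (cvg_stable_norm hS stable).
- by move=> s s0; exact: (cvg_stable_norm hS stable (el s s0)).
move=> s eta s0 eta0 /=.
(* The curves [e (s + h)] and [S h (e s)] both start from [e s]; subtracting their right difference
   quotients isolates the deviation of [e] from the semigroup flow. *)
have : h^-1 *: (e (s + h) - S h (e s)) @[h --> 0^'+] --> e' s - B (e s).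
  have gSs : h^-1 *: (S h (e s) - e s) @[h --> 0^'+] --> B (e s) by exact: (gS _ _).1.
  apply: cvg_trans (cvgB (ed s s0) gSs); apply: near_eq_cvg.
  by near=> h; rewrite !fctE -scalerBr; congr (_ *: _); rewrite opprB addrA subrK.
(* The slack is [eta / M] because passing from the norm to [N] multiplies the deviation by [M]; for
   the same reason [a] and [b] become [M * a] and [M * b]. *)
move/cvg_norm => /cvgr_le => /(_ (a * `|e s| + b + eta / M)).
have lt1 : `|e' s - B (e s)| < a * `|e s| + b + eta / M.
  by rewrite (le_lt_trans (eB s s0))// ltrDl divr_gt0.
move=> /(_ lt1); apply: filter_app; near=> h => He.
have h0 : 0 < h by near: h; exact: nbhs_right_gt.
have {}He : `|e (s + h) - S h (e s)| <= h * (a * `|e s| + b + eta / M).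
  by move: He; rewrite normrZ gtr0_norm ?invr_gt0// ler_pdivrMl.
rewrite -{1}(subrK (S h (e s)) (e (s + h))) addrC.
apply: le_trans (stable_normD hS stable _ _) _ => //.
apply: lerD; first by apply: (stable_norm_semigroup hS stable); exact: ltW.
apply: le_trans (Nle _) _.
apply: le_trans (ler_wpM2l (ltW M0) He) _.
rewrite mulrCA ler_pM2l//.
have -> : M * (a * `|e s| + b + eta / M) = M * a * `|e s| + M * b + eta.
  by field; rewrite gt_eqF.
by rewrite !lerD2r ler_wpM2l// mulr_ge0// ltW.
Unshelve. all: by end_near. Qed.

(** * The generator on the embedded space *)

Lemma continuous_linear_bound (R : realType) (V W : normedModType R) (f : V -> W) :
  linear f -> continuous f -> exists2 L, 0 < L & forall x, `|f x| <= L * `|x|.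
Proof.
move=> lf cf; pose g : {linear V -> W} := HB.pack f (GRing.isLinear.Build _ _ _ _ _ lf).
have /linear_boundedP[r [_ H]] : bounded_near g (nbhs (0 : V)).
  exact/linear_bounded_continuous.
exists (Num.max 0 r + 1); first by rewrite ltr_pwDr// le_max lexx.
by apply: (H); rewrite ltr_pwDr// le_max lexx orbT.
Qed.

Lemma dense_subspace_approx (R : realType) (X : normedModType R) (D : set X) (x : X)
  (eps : R) : dense D -> 0 < eps -> exists2 y, D y & `|x - y| < eps.
Proof.
move=> dD eps0.
have [|y [/= xy Dy]] := dD (ball x eps) _ (@ball_open _ _ x eps).
  by exists x; exact: ballxx.
by exists y => //; move: xy; rewrite -ball_normE.
Qed.

Section semigroup_linearity.
Context (R : realType) (V : normedModType R) (S : R -> V -> V).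
Hypothesis hS : C0_semigroup S.

Lemma semigroup0 t : 0 <= t -> S t 0 = 0.
Proof.
move=> t0; have := C0_linear hS t0 (-1) 0 0.
by rewrite scaleN1r oppr0 addr0 => ->; rewrite scaleN1r addNr.
Qed.

Lemma semigroupZ t a v : 0 <= t -> S t (a *: v) = a *: S t v.
Proof.
by move=> t0; have := C0_linear hS t0 a v 0; rewrite addr0 semigroup0// addr0.
Qed.

Lemma semigroupB t u v : 0 <= t -> S t (u - v) = S t u - S t v.
Proof.
move=> t0; have := C0_linear hS t0 (-1) v u; rewrite !scaleN1r => SB.
by rewrite addrC SB addrC.
Qed.

End semigroup_linearity.

(** Strong continuity bounds each orbit near 0, but on an interval that depends on the vector. If no
    uniform bound existed, there would be times [h_n <= 1/(n+1)] at which the norm of [S h_n]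
    exceeds [n+1]; these operators are pointwise bounded, which contradicts Banach-Steinhaus. *)
Lemma C0_semigroup_bounded_near0 (R : realType) (V : completeNormedModType R)
    (S : R -> V -> V) : C0_semigroup S ->
  exists delta C : R, [/\ 0 < delta, 0 < C &
    forall (h : R) v, 0 <= h <= delta -> `|S h v| <= C * `|v|].
Proof.
move=> hS; apply: contrapT => noC.
have bad (n : nat) : exists hv : R * V,
    0 <= hv.1 <= n.+1%:R^-1 /\ n.+1%:R * `|hv.2| < `|S hv.1 hv.2|.
  apply: contrapT => no; apply: noC; exists n.+1%:R^-1, n.+1%:R; split => //.
  by move=> h v hn; rewrite leNgt; apply/negP => lt; apply: no; exists (h, v).
have [hv hvP] := choice bad.
pose F := [set S (hv n).1 | n in [set: nat]].
have hv0 n : 0 <= (hv n).1 by have [/andP[]] := hvP n.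
have linS n := C0_linear hS (hv0 n).
have Fbl f : F f -> bounded_fun_norm f /\ linear f.
  move=> [n _ <-]; split; last exact: linS.
  have [L L0 SL] := continuous_linear_bound (linS n) (C0_bounded hS (hv0 n)).
  move=> r; exists (L * r) => x xr; apply: le_trans (SL x) _.
  by rewrite ler_wpM2l// ltW.
have Fpt : pointwise_bounded F.
  move=> x.
  have : \forall h \near 0^'+, `|S h x| <= `|x| + 1.
    have /cvg_norm/cvgr_le := @C0_strong _ _ _ hS x; by apply; rewrite ltrDl.
  rewrite near_withinE near_simpl => /nbhs_ballP[e /= e0 He].
  have {}He h : 0 <= h < e -> `|S h x| <= `|x| + 1.
    move=> /andP[]; rewrite le_eqVlt => /predU1P[<- _|h0 he].
      by rewrite (C0_0 hS) lerDl.
    by apply: He => //; rewrite /ball /= sub0r normrN gtr0_norm.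
  (* For [n >= N] the time [h_n] is below [e], where the orbit of [x] is under control; the finitely
     many earlier indices are covered by the sum. *)
  pose N := Num.truncn e^-1.
  exists (`|x| + 1 + \sum_(n < N) `|S (hv n).1 x|) => _ [n _ <-].
  have [nN|Nn] := ltnP n N.
    rewrite (bigD1 (Ordinal nN))//= addrCA lerDl addr_ge0//.
    exact: sumr_ge0.
  apply: (@le_trans _ _ (`|x| + 1)); last by rewrite lerDl; exact: sumr_ge0.
  apply: He; rewrite hv0 /=; have [/andP[_ h1] _] := hvP n.
  rewrite (le_lt_trans h1)// invf_plt ?posrE//.
  by apply: lt_le_trans (truncnS_gt _) _; rewrite ler_nat ltnS.
have [M HM] := Banach_Steinhauss Fbl Fpt 1.
have [_] := hvP (Num.truncn M); set n := Num.truncn M; set v := (hv n).2.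
have [->|v0] := eqVneq v 0.
  by rewrite (semigroup0 hS)// !normr0 mulr0 ltxx.
have nv : 0 < `|v| by rewrite normr_gt0.
have := HM (S (hv n).1) (ex_intro2 _ _ n I erefl) (`|v|^-1 *: v).
rewrite normrZ gtr0_norm ?invr_gt0// mulVf ?gt_eqF// => /(_ (lexx _)).
rewrite (semigroupZ hS)// normrZ gtr0_norm ?invr_gt0// ler_pdivrMl// => le1 lt1.
have := lt_le_trans lt1 le1; rewrite mulrC ltr_pM2l// ltNge => /negP; apply.
exact/ltW/truncnS_gt.
Qed.

Lemma subr_split (V : zmodType) (a b c d : V) : a - b = c - d + (a - c - (b - d)).
Proof. by rewrite -{1}(subrK c a) -{1}(subrK d b) opprD addrACA addrC. Qed.

Section generator_estimates.
Context (R : realType) (V : normedModType R).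
Variables (S : R -> V -> V) (D : set V) (A : V -> V).
Hypotheses (hS : C0_semigroup S) (gS : generates D A S).
Variables (delta C : R).
Hypotheses (delta0 : 0 < delta) (C0 : 0 < C)
  (near0 : forall (h : R) v, 0 <= h <= delta -> `|S h v| <= C * `|v|).

Lemma generator_quotient v : D v -> h^-1 *: (S h v - v) @[h --> 0^'+] --> A v.
Proof. by move=> Dv; exact: (gS _ _).1. Qed.

Lemma generator_le v K : D v ->
  (forall h : R, 0 <= h <= delta -> `|S h v - v| <= K * h) -> `|A v| <= K.
Proof.
move=> Dv H; apply: (cvgr_to_le (cvg_norm (generator_quotient Dv))).
near=> h; have h0 : 0 < h by near: h; exact: nbhs_right_gt.
rewrite normrZ gtr0_norm ?invr_gt0// ler_pdivrMl// mulrC; apply: H.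
by rewrite (ltW h0); near: h; exact: nbhs_right_le.
Unshelve. all: by end_near. Qed.

(* Split [0, h] into n steps: |S_h v - v| <= C n |S_(h/n) v - v| -> C h |A v|. *)
Lemma semigroup_increment v (h : R) : D v -> 0 <= h <= delta ->
  `|S h v - v| <= C * h * `|A v|.
Proof.
move=> Dv /andP[]; rewrite le_eqVlt => /predU1P[<- _|h0 hd].
  by rewrite (C0_0 hS) subrr normr0 mulr0 mul0r.
have step n : `|S h v - v| <= C * h * `|(h / n.+1%:R)^-1 *: (S (h / n.+1%:R) v - v)|.
  set s := h / n.+1%:R; have s0 : 0 < s by rewrite divr_gt0.
  have split m : (m <= n.+1)%N -> `|S (m%:R * s) v - v| <= m%:R * (C * `|S s v - v|).
    elim: m => [_|m IH mn]; first by rewrite !mul0r (C0_0 hS) subrr normr0.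
    have ms0 : 0 <= m%:R * s by rewrite mulr_ge0// ltW.
    rewrite -natr1 mulrDl mul1r (C0_add hS) ?(ltW s0)//.
    rewrite -(subrK (S (m%:R * s) v) (S _ (S s v))) -addrA.
    apply: le_trans (ler_normD _ _) _; rewrite mulrDl mul1r [leRHS]addrC.
    (* The new summand is [S (m s)] applied to [S s v - v], and [m s <= delta], so it costs one
       factor [C] whatever [m] is. *)
    apply: lerD; last exact: IH (ltnW mn).
    rewrite -(semigroupB hS)//; apply: near0; rewrite ms0 /=.
    apply: le_trans hd; rewrite /s mulrA ler_pdivrMr// mulrC ler_pM2l//.
    by rewrite ler_nat ltnW.
  have := split n.+1 (leqnn _).
  have -> : n.+1%:R * s = h by rewrite /s mulrC divfK.
  move=> /le_trans; apply; rewrite normrZ gtr0_norm ?invr_gt0//.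
  rewrite le_eqVlt; apply/orP; left; apply/eqP; rewrite /s invf_div.
  by move: (n.+1%:R : R) => N; field; rewrite gt_eqF.
apply/ler_addgt0Pr => eta eta0.
have : \forall s \near 0^'+, `|s^-1 *: (S s v - v)| <= `|A v| + eta / (C * h).
  have /cvg_norm/cvgr_le := generator_quotient Dv; apply.
  by rewrite ltrDl divr_gt0// mulr_gt0.
rewrite near_withinE near_simpl => /nbhs_ballP[e /= e0 He].
(* One more than this number of steps exceeds [h / e], so that each step is shorter than [e]. *)
apply: le_trans (step (Num.truncn (h / e))) _.
have Ch0 : 0 < C * h by exact: mulr_gt0.
have -> : C * h * `|A v| + eta = C * h * (`|A v| + eta / (C * h)).
  by rewrite [RHS]mulrDr [X in _ = _ + X]mulrC divfK ?gt_eqF.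
rewrite ler_pM2l//; apply: He; last exact: divr_gt0.
rewrite /ball /= sub0r normrN gtr0_norm ?divr_gt0// ltr_pdivrMr// mulrC.
by rewrite -ltr_pdivrMr// truncnS_gt.
Qed.

End generator_estimates.

Section range_estimate.
Context (R : realType) (V X : normedModType R).
Variables (S : R -> V -> V) (D : set V) (A B : V -> V) (iota : {linear X -> V}).
Variables (D0 : set X).
Hypotheses (hS : C0_semigroup S) (gS : generates D A S) (linA : linear_on D A).
Hypotheses (linB : linear B) (contB : continuous B).
Hypotheses (cont_iota : continuous iota) (iotaD : range iota `<=` D).
Hypotheses (denseD0 : dense D0).
Variables (delta C rho : R).
Hypotheses (delta0 : 0 < delta) (C0 : 0 < C)
  (near0 : forall (h : R) v, 0 <= h <= delta -> `|S h v| <= C * `|v|).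
Hypothesis consistent : forall x, D0 x -> `|B (iota x) - A (iota x)| <= rho * `|x|.

Let Aiota x : D (iota x). Proof. by apply: iotaD; exists x. Qed.

Let iota_bound : exists2 L, 0 < L & forall x, `|iota x| <= L * `|x|.
Proof.
by apply: continuous_linear_bound => // a x y; rewrite linearP.
Qed.

(* The closed graph theorem for [A \o iota], with the explicit bound that
   [consistent] provides on the dense set. *)
Lemma generator_bounded_on_range :
  exists2 L, 0 < L & forall x, `|A (iota x)| <= L * `|x|.
Proof.
have [Li Li0 Hi] := iota_bound.
have [LB LB0 HB] := continuous_linear_bound linB contB.
pose L := LB * Li + `|rho|.
have L0 : 0 < L by rewrite ltr_pwDl// mulr_gt0.
have onD0 x : D0 x -> `|A (iota x)| <= L * `|x|.
  move=> Dx; rewrite -(subrK (B (iota x)) (A (iota x))).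
  apply: le_trans (ler_normD _ _) _; rewrite /L mulrDl addrC distrC.
  apply: lerD.
    by apply: le_trans (HB _) _; rewrite -mulrA ler_wpM2l// ltW.
  apply: le_trans (consistent Dx) _.
  by rewrite ler_wpM2r// ler_norm.
exists (C * L) => [|x]; first exact: mulr_gt0.
(* It suffices to show [|S h (iota x) - iota x| <= C * L * |x| * h]. For fixed [h] the left side is
   continuous in [x], so the estimate extends from [D0] to [X]; letting [h] tend to 0 then returns
   to [A]. *)
apply: (generator_le gS delta0 (Aiota x)) => h /[dup] hd /andP[h0 _].
have [LS LS0 HS] := continuous_linear_bound (C0_linear hS h0) (C0_bounded hS h0).
apply/ler_addgt0Pr => eta eta0.
(* [K - 1] is the total coefficient of [|x - y|] in the estimates below; the added 1 keeps [K]
   positive. The approximant [y] may depend on [h] and [eta]. *)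
pose K := (LS + 1) * Li + C * h * L + 1.
have K0 : 0 < K.
  rewrite ltr_wpDl// addr_ge0// mulr_ge0 ?(ltW L0) ?(ltW Li0)//.
    by rewrite addr_ge0// ltW.
  by rewrite mulr_ge0// ltW.
have [y Dy xy] := dense_subspace_approx x denseD0 (divr_gt0 eta0 K0).
have -> : S h (iota x) - iota x =
    (S h (iota y) - iota y) + (S h (iota (x - y)) - iota (x - y)).
  by rewrite linearB (semigroupB hS)// -subr_split.
apply: le_trans (ler_normD _ _) _.
have h1 : `|S h (iota y) - iota y| <= C * h * (L * `|y|).
  apply: le_trans (semigroup_increment hS gS C0 near0 (Aiota y) hd) _.
  by rewrite ler_wpM2l ?mulr_ge0 ?(ltW C0)// onD0.
have h2 : `|S h (iota (x - y)) - iota (x - y)| <= (LS + 1) * Li * `|x - y|.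
  apply: le_trans (ler_normB _ _) _.
  apply: (@le_trans _ _ ((LS + 1) * `|iota (x - y)|)).
    by rewrite mulrDl mul1r lerD2r.
  by rewrite -mulrA ler_wpM2l// addr_ge0// ltW.
have h3 : `|y| <= `|x| + `|x - y|.
  by rewrite -{1}(subKr x y) ler_normB.
have h4 : C * h * (L * `|y|) <= C * h * L * (`|x| + `|x - y|).
  by rewrite mulrA ler_wpM2l// mulr_ge0 ?(ltW L0)// mulr_ge0// ltW.
apply: le_trans (lerD h1 h2) _; apply: le_trans (lerD h4 (lexx _)) _.
have -> : C * h * L * (`|x| + `|x - y|) + (LS + 1) * Li * `|x - y|
   = C * L * `|x| * h + (K - 1) * `|x - y| by rewrite /K; ring.
rewrite lerD2l; apply: (@le_trans _ _ (K * `|x - y|)).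
  by rewrite ler_wpM2r// lerBlDr lerDl.
by rewrite -ler_pdivlMl// mulrC ltW.
Qed.

(** With [A] now bounded from [X], both sides are continuous in [x] and the inequality extends from
    [D0] by density. The bounds [LA] and [LB] only decide how close the approximant has to be, so
    [rho] is kept exactly. *)
Lemma consistent_on_range x : `|B (iota x) - A (iota x)| <= rho * `|x|.
Proof.
have [LA LA0 HA] := generator_bounded_on_range.
have [Li Li0 Hi] := iota_bound.
have [LB LB0 HB] := continuous_linear_bound linB contB.
apply/ler_addgt0Pr => eta eta0.
pose K := LB * Li + LA + `|rho|.
have K0 : 0 < K by rewrite ltr_pwDl// ltr_wpDl// mulr_ge0// ltW.
have [y Dy xy] := dense_subspace_approx x denseD0 (divr_gt0 eta0 K0).
have linB' u v : B (u - v) = B u - B v.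
  by have := linB (-1) v u; rewrite !scaleN1r => BB; rewrite addrC BB addrC.
have AD : A (iota x) = A (iota (x - y)) + A (iota y).
  by rewrite -(linA.1 _ _ (Aiota _) (Aiota _)) -linearD subrK.
have -> : B (iota x) - A (iota x) =
    (B (iota y) - A (iota y)) + (B (iota (x - y)) - A (iota (x - y))).
  have -> : A (iota (x - y)) = A (iota x) - A (iota y) by rewrite AD addrK.
  by rewrite (linearB iota x y) linB' -subr_split.
have h1 := consistent Dy.
have h2 : `|B (iota (x - y)) - A (iota (x - y))| <= (LB * Li + LA) * `|x - y|.
  apply: le_trans (ler_normB _ _) _; rewrite mulrDl lerD//.
  by apply: le_trans (HB _) _; rewrite -mulrA ler_wpM2l// ltW.
have h3 : rho * `|y| <= rho * `|x| + `|rho| * `|x - y|.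
  rewrite -lerBlDl -mulrBr; apply: le_trans (ler_norm _) _.
  by rewrite normrM ler_wpM2l// distrC ler_dist_dist.
apply: le_trans (ler_normD _ _) _.
apply: le_trans (lerD (le_trans h1 h3) h2) _.
rewrite -addrA lerD2l -mulrDl [`|rho| + _]addrC -/K.
by rewrite -ler_pdivlMl// mulrC ltW.
Qed.

End range_estimate.

(** * Completeness of L^2 *)

Lemma mxBE (V : zmodType) (m n : nat) (A B : 'M[V]_(m, n)) i j :
  (A - B) i j = A i j - B i j.
Proof. by rewrite !mxE. Qed.

Definition mx_measurable d (T : measurableType d) (R : realType) m n
    (f : T -> 'M[R]_(m, n)) :=
  forall i j, measurable_fun [set: T] (fun x => f x i j).

Lemma mx_measurableB d (T : measurableType d) (R : realType) m n
    (f g : T -> 'M[R]_(m, n)) :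
  mx_measurable f -> mx_measurable g -> mx_measurable (fun x => f x - g x).
Proof.
move=> mf mg i j; under eq_fun do rewrite mxBE.
by apply: measurable_funB; [exact: mf|exact: mg].
Qed.

Section L2_norm_integral.
Context d (T : measurableType d) (R : realType).
Variables (mu : {measure set T -> \bar R}) (m n : nat).
Implicit Types (f g : T -> 'M[R]_(m, n)) (u v : L2 mu m n).

Lemma measurable_fnorm_sqr f :
  mx_measurable f -> measurable_fun [set: T] (fun x => (fnorm (f x) ^+ 2)%:E).
Proof.
move=> mf; apply/measurable_EFinP.
rewrite (_ : (fun x => _) = (fun x => fdot (f x) (f x))); last first.
  by apply/funext => x; rewrite fnorm_sqr.
exact: measurable_fdot.
Qed.

Lemma L2_norm_integral v :
  (\int[mu]_x (fnorm (L2_fun v x) ^+ 2)%:E = (`|v| ^+ 2)%:E)%E.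
Proof.
rewrite [`|v|](_ : _ = L2_norm v)// L2_norm_sqr /L2_dot /Rintegral.
rewrite fineK; last exact: integrable_fin_num (L2_dot_integrable v v).
by apply: eq_integral => x _; rewrite fnorm_sqr.
Qed.

Lemma toL2_norm_integral f : sq_integrable mu f ->
  (\int[mu]_x (fnorm (f x) ^+ 2)%:E = (`|toL2 mu f| ^+ 2)%:E)%E.
Proof.
move=> fi; rewrite -L2_norm_integral; apply: ae_eq_integral => //.
- exact: measurable_fnorm_sqr fi.1.
- exact: measurable_fnorm_sqr (L2_fun_sqi _).1.
- by apply: filterS (toL2K fi) => x /= ->.
Qed.

Lemma L2_funB u v :
  {ae mu, forall x, L2_fun (u - v) x = L2_fun u x - L2_fun v x}.
Proof.
rewrite -scaleN1r; apply: filterS2 (L2_funD u (-1 *: v)) (L2_funZ (-1) v).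
by move=> x -> ->; rewrite scaleN1r.
Qed.

Lemma toL2_norm_le f c : 0 <= c -> mx_measurable f ->
  (\int[mu]_x (fnorm (f x) ^+ 2)%:E <= (c ^+ 2)%:E)%E ->
  sq_integrable mu f /\ `|toL2 mu f| <= c.
Proof.
move=> c0 mf fc; have fi : sq_integrable mu f.
  by split=> //; exact: le_lt_trans fc (ltry _).
split=> //; move: fc; rewrite toL2_norm_integral// lee_fin.
by rewrite ler_pXn2r// nnegrE.
Qed.

Lemma toL2_eq f g : mx_measurable f -> sq_integrable mu g ->
  {ae mu, forall x, f x = g x} -> toL2 mu f = toL2 mu g.
Proof.
move=> mf gi fg.
have fi : sq_integrable mu f.
  split=> //; rewrite (_ : (\int[mu]_x _)%E = (\int[mu]_x (fnorm (g x) ^+ 2)%:E)%E).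
    exact: gi.2.
  apply: ae_eq_integral => //; try exact: measurable_fnorm_sqr.
    exact: measurable_fnorm_sqr gi.1.
  by apply: filterS fg => x /= ->.
apply/L2_eqP; apply: filterS3 (toL2K fi) (toL2K gi) fg.
by move=> x -> -> ->.
Qed.

End L2_norm_integral.

Section riesz_fischer.
Context d (T : measurableType d) (R : realType).
Variables (mu : {measure set T -> \bar R}) (m n : nat).

Lemma normr_entry_le_fnorm (x : 'M[R]_(m, n)) i j : `|x i j| <= fnorm x.
Proof.
rewrite -sqrtr_sqr ler_wsqrtr// /fdot (bigD1 i)//= (bigD1 j)//= -addrA expr2 lerDl.
rewrite addr_ge0//; first by apply: sumr_ge0 => k _; rewrite -expr2 sqr_ge0.
by apply: sumr_ge0 => k _; apply: sumr_ge0 => l _; rewrite -expr2 sqr_ge0.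
Qed.

Let half_sqr : 2^-1 ^+ 2 = 4^-1 :> R. Proof. by rewrite exprVn -natrX. Qed.

Variable v : nat -> L2 mu m n.
Hypothesis v_fast : forall j, `|v j.+1 - v j| <= 4^-1 ^+ j.

Let f j x := L2_fun (v j) x.
Let mf j : mx_measurable (f j).
Proof. exact: (L2_fun_sqi (v j)).1. Qed.

(* [g j x <= H x] for all [j] gives increments of size at most
   [2^-j (H x)^(1/2)], so [f] converges geometrically wherever [H] is finite. *)
Let g j x : R := 4 ^+ j * fnorm (f j.+1 x - f j x) ^+ 2.
Let g0 j x : 0 <= g j x. Proof. by rewrite mulr_ge0 ?exprn_ge0 ?fnorm_ge0. Qed.
Let m_increment j : measurable_fun [set: T] (fun x => (fnorm (f j.+1 x - f j x) ^+ 2)%:E).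
Proof. by apply: measurable_fnorm_sqr; exact: mx_measurableB. Qed.
Let mg j : measurable_fun [set: T] (fun x => (g j x)%:E).
Proof.
under eq_fun do rewrite EFinM.
by apply: emeasurable_funM => //; exact: measurable_fnorm_sqr.
Qed.

Let H x : \bar R := (\sum_(0 <= j <oo) (g j x)%:E)%E.

Let mH : measurable_fun [set: T] H.
Proof. by apply: ge0_emeasurable_sum => //; move=> j x _ _; rewrite lee_fin. Qed.

(** By Tonelli the [j]-th term contributes at most [4^j (4^-j)^2 = 4^-j]; the geometric sum 4/3 is
    rounded up to 2. *)
Let H_int : (\int[mu]_x H x <= 2%:E)%E.
Proof.
rewrite integral_nneseries//; last by move=> *; rewrite lee_fin.
apply: lime_le.
  by apply: is_cvg_nneseries => k _ _; apply: integral_ge0 => x _; rewrite lee_fin.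
apply: nearW => N.
apply: (@le_trans _ _ (\sum_(0 <= j < N) (4^-1 ^+ j)%:E)%E).
  apply: lee_sum => j _.
  under eq_integral do rewrite EFinM.
  rewrite ge0_integralZl//; last by move=> x _; rewrite lee_fin sqr_ge0.
  have -> : (\int[mu]_x (fnorm (f j.+1 x - f j x) ^+ 2)%:E
     = (`|v j.+1 - v j| ^+ 2)%:E)%E.
    rewrite -L2_norm_integral; apply: ae_eq_integral => //.
      exact: measurable_fnorm_sqr (L2_fun_sqi _).1.
    by apply: filterS (L2_funB (v j.+1) (v j)) => x /= ->.
  rewrite lee_fin -ler_pdivlMl ?exprn_gt0// -exprVn -exprD addnn -muln2 exprM.
  by rewrite ler_pXn2r// nnegrE// exprn_ge0// invr_ge0.
rewrite sumEFin lee_fin.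
suff -> : \sum_(0 <= j < N) 4^-1 ^+ j = (4 / 3) * (1 - 4^-1 ^+ N) :> R.
  have : 0 <= 4^-1 ^+ N :> R by rewrite exprn_ge0// invr_ge0.
  lra.
elim: N => [|N IH]; first by rewrite big_nil expr0 subrr mulr0.
by rewrite big_nat_recr//= IH exprS; field.
Qed.

Let bad := [set x | H x = +oo%E].

Let m_bad : measurable bad.
Proof.
have -> : bad = [set: T] `&` H @^-1` [set +oo%E] by rewrite setTI.
exact: mH.
Qed.

Let H0 x : (0 <= H x)%E. Proof. by apply: nneseries_ge0 => j _ _; rewrite lee_fin. Qed.

Let bad0 : mu bad = 0%E.
Proof.
have iH : mu.-integrable setT H.
  apply/integrableP; split=> //; under eq_integral do rewrite gee0_abs//.
  exact: le_lt_trans H_int (ltry _).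
apply/negligibleP => //; apply: negligibleS (integrable_ae measurableT iH).
by move=> x /= Hx; apply/not_implyP; split=> //; rewrite Hx.
Qed.

Let r x : R := Num.sqrt (fine (H x)).

Let r_sqr x : r x ^+ 2 = fine (H x).
Proof. by rewrite sqr_sqrtr// fine_ge0. Qed.

(** Zeroing the sequence on the null set where [H] is infinite makes it converge at every point, so
    the limit is measurable as an everywhere pointwise limit. *)
Let fb j x : 'M[R]_(m, n) := \1_(~` bad) x *: f j x.

Let fb_good j x : ~ bad x -> fb j x = f j x.
Proof. by move=> bx; rewrite /fb indicE mem_set ?scale1r. Qed.

Let fb_bad j x : bad x -> fb j x = 0.
Proof. by move=> bx; rewrite /fb indicE memNset ?scale0r//; apply. Qed.

Let H_fin x : ~ bad x -> H x = (fine (H x))%:E.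
Proof.
move=> bx; rewrite fineK// ge0_fin_numE// lt_neqAle leey andbT.
by apply/eqP.
Qed.

Let step j x : fnorm (fb j.+1 x - fb j x) <= 2^-1 ^+ j * r x.
Proof.
have [bx|bx] := pselect (bad x).
  rewrite !fb_bad// subrr -(scale0r 0) fnormZ normr0 mul0r.
  by rewrite mulr_ge0// ?sqrtr_ge0// exprn_ge0// invr_ge0.
rewrite !fb_good// -(@ler_pXn2r _ 2)// ?nnegrE ?fnorm_ge0//; last first.
  by rewrite mulr_ge0// ?sqrtr_ge0// exprn_ge0// invr_ge0.
rewrite exprMn r_sqr.
rewrite -exprM mulnC exprM half_sqr.
rewrite exprVn ler_pdivlMl ?exprn_gt0// -lee_fin -H_fin// -/(g j x).
rewrite /H (nneseries_split 0%N j.+1) => [|k _]; last by rewrite lee_fin.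
rewrite add0n big_nat_recr//=.
apply: le_trans (leeDl _ _); last first.
  by apply: nneseries_ge0 => k _ _; rewrite lee_fin.
by apply: leeDr; apply: sume_ge0 => k _; rewrite lee_fin.
Qed.

Let tail j k x : fnorm (fb (j + k)%N x - fb j x) <= 2 * 2^-1 ^+ j * r x.
Proof.
have r0 : 0 <= r x by rewrite sqrtr_ge0.
have half0 i : 0 <= 2^-1 ^+ i :> R by rewrite exprn_ge0// invr_ge0.
(* The induction on [k] needs the exact partial sum of the geometric series. *)
suff : fnorm (fb (j + k)%N x - fb j x) <= 2 * (2^-1 ^+ j - 2^-1 ^+ (j + k)%N) * r x.
  move=> /le_trans; apply; rewrite ler_wpM2r// ler_wpM2l// gerBl//.
elim: k => [|k IH].
  by rewrite addn0 !subrr mulr0 mul0r -(scale0r 0) fnormZ normr0 mul0r.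
rewrite addnS -(subrK (fb (j + k)%N x) (fb _.+1 x)) -addrA.
apply: le_trans (fnormD _ _) _; apply: le_trans (lerD (step _ _) IH) _.
by rewrite -mulrDl ler_wpM2r// exprS; lra.
Qed.

Let fb_cvg x a b : cvgn (fun k => fb k x a b).
Proof.
apply/cauchy_cvgP/cauchy_exP => e e0.
have : (2 * r x) * 2^-1 ^+ j @[j --> \oo] --> 0.
  by apply: (@cvg_geometric _ (2 * r x)); rewrite gtr0_norm ?invf_lt1 ?ltr1n.
move/cvgr_lt => /(_ _ e0) [j _ /(_ j (leqnn _)) /= Hj].
exists (fb j x a b); exists j => // k /= jk.
rewrite /ball /= distrC (le_lt_trans _ Hj)//.
have := tail j (k - j)%N x; rewrite subnKC// mulrAC; apply: le_trans.
by apply: le_trans (normr_entry_le_fnorm _ a b); rewrite !mxE.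
Qed.

Let l x : 'M[R]_(m, n) := \matrix_(a, b) limn (fun k => fb k x a b).

Let ml : mx_measurable l.
Proof.
move=> a b; apply: (@measurable_fun_cvg _ _ _ _ (fun k x => fb k x a b)).
  move=> k; under eq_fun do rewrite mxE.
  apply: measurable_funM; last exact: mf.
  exact: measurable_indic (measurableC m_bad).
by move=> x _; rewrite [l x a b]mxE; exact: fb_cvg.
Qed.

Let l_tail j x : fnorm (l x - fb j x) ^+ 2 <= 4 * 4^-1 ^+ j * fine (H x).
Proof.
have half0 i : 0 <= 2^-1 ^+ i :> R by rewrite exprn_ge0// invr_ge0.
have -> : 4 * 4^-1 ^+ j * fine (H x) = (2 * 2^-1 ^+ j * r x) ^+ 2.
  rewrite !exprMn r_sqr.
  congr (_ * _ * _); first by rewrite -natrX.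
  by rewrite -exprM mulnC exprM half_sqr.
have : fnorm (fb k x - fb j x) ^+ 2 @[k --> \oo] --> fnorm (l x - fb j x) ^+ 2.
  rewrite fnorm_sqr /fdot; under eq_fun do rewrite fnorm_sqr /fdot.
  apply: cvg_big => [|a _]; first exact: add_continuous.
  apply: cvg_big => [|b _]; first exact: add_continuous.
  under eq_fun do rewrite !mxBE.
  rewrite mxBE [l x a b]mxE.
  by apply: cvgM; apply: cvgB; (exact: fb_cvg || exact: cvg_cst).
move/cvgr_to_le; apply; exists j => // k /= jk.
rewrite ler_pXn2r ?nnegrE ?fnorm_ge0 ?mulr_ge0 ?sqrtr_ge0//.
by have := tail j (k - j)%N x; rewrite subnKC.
Qed.

(** Integrating [l_tail] gives [8 * 4^-j]; 8 is enlarged to 9 to obtain a perfect square, ready for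
    taking norms. *)
Let l_int j : (\int[mu]_x (fnorm (l x - f j x) ^+ 2)%:E <= ((3 * 2^-1 ^+ j) ^+ 2)%:E)%E.
Proof.
apply: (@le_trans _ _ (\int[mu]_x ((4 * 4^-1 ^+ j)%:E * H x))%E).
  apply: ae_ge0_le_integral => //.
  - by move=> x _; rewrite lee_fin sqr_ge0.
  - by apply: measurable_fnorm_sqr; exact: mx_measurableB.
  - by move=> x _; rewrite mule_ge0// lee_fin mulr_ge0// exprn_ge0// invr_ge0.
  - exact: emeasurable_funM.
  exists bad; split => // x /= nle; apply: contrapT => bx; apply: nle => _.
  by rewrite H_fin// -EFinM lee_fin -(fb_good j bx).
have c0 : (0 <= (4 * 4^-1 ^+ j)%:E :> \bar R)%E.
  by rewrite lee_fin mulr_ge0// exprn_ge0// invr_ge0.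
rewrite (ge0_integralZl mu measurableT mH (fun x _ => H0 x) c0).
apply: (@le_trans _ _ ((4 * 4^-1 ^+ j)%:E * 2%:E)%E).
  by apply: lee_wpmul2l => //; rewrite lee_fin mulr_ge0// exprn_ge0// invr_ge0.
rewrite -EFinM lee_fin exprMn -exprM mulnC exprM half_sqr.
have : 0 <= 4^-1 ^+ j :> R by rewrite exprn_ge0// invr_ge0.
by move: (4^-1 ^+ j) => t t0; lra.
Qed.

Lemma fast_cauchy_cvg : cvgn v.
Proof.
have l_sqi : sq_integrable mu l.
  have d0 : sq_integrable mu (fun x => l x - f 0%N x).
    by split; [exact: mx_measurableB|exact: le_lt_trans (l_int 0) (ltry _)].
  have := sqi_lin 1 d0 (L2_fun_sqi (v 0%N)).
  rewrite (_ : _ + _ = l)//; apply/funext => x.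
  by rewrite [LHS](_ : _ = 1 *: (l x - f 0%N x) + f 0%N x)// scale1r subrK.
apply/cvg_ex; exists (toL2 mu l).
have bound j : `|toL2 mu l - v j| <= 3 * 2^-1 ^+ j.
  have half0 : 0 <= 2^-1 ^+ j :> R by rewrite exprn_ge0// invr_ge0.
  rewrite -(@ler_pXn2r _ 2)// ?nnegrE ?mulr_ge0// -lee_fin.
  apply: le_trans (l_int j); rewrite -L2_norm_integral le_eqVlt.
  apply/orP; left; apply/eqP; apply: ae_eq_integral => //.
  - exact: measurable_fnorm_sqr (L2_fun_sqi _).1.
  - by apply: measurable_fnorm_sqr; exact: mx_measurableB.
  - by apply: filterS2 (L2_funB (toL2 mu l) (v j)) (toL2K l_sqi) => x /= -> ->.
apply/cvgrPdist_lt => e e0.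
have : 3 * 2^-1 ^+ j @[j --> \oo] --> (0 : R).
  by apply: (@cvg_geometric _ 3); rewrite gtr0_norm ?invf_lt1 ?ltr1n.
move/cvgr_lt => /(_ _ e0); apply: filterS => j; exact: le_lt_trans.
Qed.

End riesz_fischer.

(** The centres [v j] of balls of radius [4^-j / 2] belonging to the Cauchy filter form a fast
    Cauchy sequence, since two members of the filter always meet. Its limit is the limit of the
    filter. *)
Lemma L2_complete d (T : measurableType d) (R : realType)
    (mu : {measure set T -> \bar R}) (m n : nat) (F : set_system (L2 mu m n)) :
  ProperFilter F -> cauchy F -> cvg F.
Proof.
move=> FF /cauchyP cF.
have rad0 j : 0 < 4^-1 ^+ j / 2 :> R by rewrite divr_gt0// exprn_gt0// invr_gt0.
have [v vF] := choice (fun j => cF _ (rad0 j)).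
have near_v j w : ball (v j) (4^-1 ^+ j / 2) w -> `|v j - w| < 4^-1 ^+ j / 2.
  by rewrite -ball_normE.
have fast j : `|v j.+1 - v j| <= 4^-1 ^+ j.
  have [w [w1 w2]] := filter_ex (filterI (vF j) (vF j.+1)).
  have := near_v _ _ w1; have := near_v _ _ w2.
  have := ler_distD w (v j.+1) (v j); rewrite [`|w - _|]distrC exprS.
  have : 0 < 4^-1 ^+ j :> R by rewrite exprn_gt0// invr_gt0.
  by lra.
have /cvg_ex[l vl] := fast_cauchy_cvg fast.
apply/cvg_ex; exists l; apply/cvgrPdist_lt => e e0.
have e20 : 0 < e / 2 by rewrite divr_gt0.
have /cvgrPdist_lt/(_ _ e20) near_l := vl.
have : 2^-1 * 4^-1 ^+ j @[j --> \oo] --> (0 : R).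
  by apply: (@cvg_geometric _ 2^-1); rewrite gtr0_norm ?invf_lt1 ?ltr1n.
move/cvgr_lt => /(_ _ e20) small.
have [j [lj sj]] := filter_ex (filterI near_l small).
apply: filterS (vF j) => w /near_v vw.
have := ler_distD (v j) l w; rewrite /= in lj sj vw *; lra.
Qed.

HB.instance Definition _ d (T : measurableType d) (R : realType)
    (mu : {measure set T -> \bar R}) (m n : nat) :=
  Uniform_isComplete.Build (L2 mu m n) (@L2_complete d T R mu m n).

(** * Hilbert-Schmidt operators *)

Lemma linear_bound_continuous (R : realType) (V W : normedModType R) (f : V -> W) c :
  linear f -> (forall x, `|f x| <= c * `|x|) -> continuous f.
Proof.
move=> lf fc; pose g : {linear V -> W} := HB.pack f (GRing.isLinear.Build _ _ _ _ _ lf).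
apply/(linear_bounded_continuous g)/linear_boundedP.
exists c; split; first exact: num_real.
move=> r cr x; apply: le_trans (fc x) _.
by rewrite ler_wpM2r// ltW.
Qed.

Lemma fnorm_col (R : realType) p (x : 'cV[R]_p) : fnorm x ^+ 2 = \sum_i x i 0 ^+ 2.
Proof.
by rewrite fnorm_sqr; apply: eq_bigr => i _; rewrite big_ord1 expr2.
Qed.

Lemma fnorm_rows (R : realType) m n (A : 'M[R]_(m, n)) :
  fnorm A ^+ 2 = \sum_i fnorm (row i A)^T ^+ 2.
Proof.
rewrite fnorm_sqr; apply: eq_bigr => i _; rewrite fnorm_col.
by apply: eq_bigr => j _; rewrite !mxE expr2.
Qed.

Lemma mulmx_col_fdot (R : realType) m n (A : 'M[R]_(m, n)) (x : 'cV[R]_n) i :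
  (A *m x) i 0 = fdot (row i A)^T x.
Proof.
by rewrite mxE /fdot; apply: eq_bigr => j _; rewrite big_ord1 !mxE.
Qed.

Lemma measurable_fun_Rint (d1 d2 : measure_display) (T1 : measurableType d1)
    (T2 : measurableType d2) (R : realType)
    (m2 : {sigma_finite_measure set T2 -> \bar R}) (h : T1 * T2 -> R) :
  measurable_fun [set: T1 * T2] h ->
  measurable_fun [set: T1] (fun x => \int[m2]_y h (x, y)).
Proof.
move=> mh; apply: (measurableT_comp (@fine_measurable _ setT measurableT)) => //.
have mE : measurable_fun [set: T1 * T2] (EFin \o h) by apply/measurable_EFinP.
rewrite [X in measurable_fun _ X](_ : _ = fun x =>
  (\int[m2]_y (EFin \o h)^\+ (x, y) - \int[m2]_y (EFin \o h)^\- (x, y))%E).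
  apply: emeasurable_funB.
    by apply: measurable_fun_fubini_tonelli_F => //; exact: measurable_funepos.
  by apply: measurable_fun_fubini_tonelli_F => //; exact: measurable_funeneg.
apply/funext => x; rewrite integralE; congr (_ - _)%E; apply: eq_integral => y _.
  by rewrite !funeposE.
by rewrite !funenegE.
Qed.

Lemma normr_L2_dot_le d (T : measurableType d) (R : realType)
    (mu : {measure set T -> \bar R}) m n (u v : L2 mu m n) :
  `|L2_dot u v| <= `|u| * `|v|.
Proof.
rewrite ler_norml; apply/andP; split; last exact: L2_dot_CS.
rewrite lerNl -mulN1r -L2_dotZl.
by apply: le_trans (L2_dot_CS _ _) _; rewrite L2_normZ normrN1 mul1r.
Qed.

Lemma mxDZE (V : realType) (m n : nat) (a : V) (A B : 'M[V]_(m, n)) i j :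
  (a *: A + B) i j = a * A i j + B i j.
Proof. by rewrite !mxE. Qed.

Section hilbert_schmidt.
Context d (T : measurableType d) (R : realType).
Variables (mu : {sigma_finite_measure set T -> \bar R}) (p : nat).
Implicit Types (s : T * T -> 'M[R]_p) (v w : L2 mu p 1).

Definition kernel_integral s (w : T -> 'cV[R]_p) (x : T) : 'cV[R]_p :=
  \col_i \int[mu]_y (s (x, y) *m w y) i 0.

Lemma integral_operatorE s v :
  integral_operator mu s v = toL2 mu (kernel_integral s (L2_fun v)).
Proof. by []. Qed.

Lemma measurable_kernel_integral s (w : T -> 'cV[R]_p) :
  mx_measurable s -> mx_measurable w -> mx_measurable (kernel_integral s w).
Proof.
move=> ms mw i j; under eq_fun do rewrite mxE.
apply: (measurable_fun_Rint mu (h := fun z => (s z *m w z.2) i 0)).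
under eq_fun do rewrite mxE.
apply: measurable_sum => k; apply: measurable_funM => //.
exact: measurableT_comp (mw k 0) measurable_snd.
Qed.

(** Rows are transposed into columns so that each coordinate of the kernel integral is an L^2 inner
    product with [v]; linearity and Cauchy-Schwarz are then inherited from [L2_dot]. *)
Let row_of s i x : T -> 'cV[R]_p := fun y => (row i (s (x, y)))^T.

Lemma ae_rows s : sq_integrable (mu \x mu)%E s ->
  {ae mu, forall x, forall i, sq_integrable mu (row_of s i x)}.
Proof.
move=> [ms si].
have mF := measurable_fnorm_sqr (f := s) ms.
have sq0 (z : T * T) : (0 <= (fnorm (s z) ^+ 2)%:E)%E by rewrite lee_fin sqr_ge0.
rewrite fubini_tonelli1// in si.
have iF : mu.-integrable setT (fubini_F mu (fun z => (fnorm (s z) ^+ 2)%:E)).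
  apply/integrableP; split; first exact: measurable_fun_fubini_tonelli_F mF sq0.
  under eq_integral => x _.
    rewrite gee0_abs; last by apply: integral_ge0 => y _; rewrite lee_fin sqr_ge0.
    over.
  exact: si.
apply: filterS (integrable_ae measurableT iF) => x /(_ I) /fin_numPlt /andP[_ xfin] i.
have mrow : mx_measurable (row_of s i x).
  move=> a b; rewrite [X in measurable_fun _ X](_ : _ = fun y => s (x, y) i a).
    exact: measurableT_comp (ms i a) _.
  by apply/funext => y; rewrite !mxE.
split=> //; apply: le_lt_trans xfin; apply: ge0_le_integral => //.
- by move=> y _; rewrite lee_fin sqr_ge0.
- exact: measurable_fnorm_sqr mrow.
- by apply: (measurable_fnorm_sqr (f := fun y => s (x, y))) => a b;
    exact: measurableT_comp (ms a b) _.
move=> y _; rewrite lee_fin [leRHS]fnorm_rows (bigD1 i)//= lerDl.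
by apply: sumr_ge0 => j _; exact: sqr_ge0.
Qed.

Lemma kernel_integral_dot s v : sq_integrable (mu \x mu)%E s ->
  {ae mu, forall x, forall i,
    kernel_integral s (L2_fun v) x i 0 = L2_dot (toL2 mu (row_of s i x)) v}.
Proof.
move=> si; apply: filterS (ae_rows si) => x rows i.
rewrite mxE /L2_dot; apply: ae_eq_Rint.
- under eq_fun do rewrite mulmx_col_fdot.
  exact: measurable_fdot (rows i).1 (L2_fun_sqi v).1.
- exact: measurable_fdot (L2_fun_sqi _).1 (L2_fun_sqi v).1.
by apply: filterS (toL2K (rows i)) => y ->; rewrite mulmx_col_fdot.
Qed.

(** Cauchy-Schwarz is applied to each row; the squared norms of the rows add up to the squared
    Frobenius norm of the kernel. *)
Lemma kernel_integral_le s v : sq_integrable (mu \x mu)%E s ->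
  {ae mu, forall x, ((fnorm (kernel_integral s (L2_fun v) x) ^+ 2)%:E <=
     (\int[mu]_y (fnorm (s (x, y)) ^+ 2)%:E) * (`|v| ^+ 2)%:E)%E}.
Proof.
move=> si; apply: filterS2 (ae_rows si) (kernel_integral_dot v si) => x rows dots.
have mrow i : measurable_fun [set: T] (fun y => (fnorm (row_of s i x y) ^+ 2)%:E).
  exact: measurable_fnorm_sqr (rows i).1.
rewrite (_ : (\int[mu]_y _)%E = (\sum_i `|toL2 mu (row_of s i x)| ^+ 2)%:E).
  rewrite -EFinM lee_fin fnorm_col mulr_suml; apply: ler_sum => i _.
  rewrite dots -exprMn -real_normK ?num_real// ler_pXn2r ?nnegrE ?mulr_ge0//.
  exact: normr_L2_dot_le.
have sumE y : (fnorm (s (x, y)) ^+ 2)%:E = (\sum_i (fnorm (row_of s i x y) ^+ 2)%:E)%E.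
  by rewrite fnorm_rows -sumEFin.
under eq_integral do rewrite sumE.
rewrite ge0_integral_sum//; last by move=> i y _; rewrite lee_fin sqr_ge0.
by rewrite -sumEFin; apply: eq_bigr => i _; rewrite toL2_norm_integral.
Qed.

(** The Hilbert-Schmidt bound: [kernel_integral_le] integrated in [x], with Tonelli. The square
    integrability in the conclusion guarantees that [toL2] returns the class of the kernel integral
    and not its default value 0. *)
Lemma integral_operator_bound s v : sq_integrable (mu \x mu)%E s ->
  sq_integrable mu (kernel_integral s (L2_fun v)) /\
  `|integral_operator mu s v| <= `|toL2 (mu \x mu)%E s| * `|v|.
Proof.
move=> si; rewrite integral_operatorE; apply: toL2_norm_le; first by rewrite mulr_ge0.
  exact: measurable_kernel_integral si.1 (L2_fun_sqi v).1.
have mF := measurable_fnorm_sqr (f := s) si.1.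
have sq0 (z : T * T) : (0 <= (fnorm (s z) ^+ 2)%:E)%E by rewrite lee_fin sqr_ge0.
rewrite exprMn EFinM -toL2_norm_integral// fubini_tonelli1//.
rewrite -ge0_integralZr//; last 2 first.
- exact: measurable_fun_fubini_tonelli_F mF sq0.
- by move=> x _; apply: integral_ge0 => y _; exact: sq0.
apply: ae_ge0_le_integral => //.
- by move=> x _; rewrite lee_fin sqr_ge0.
- apply: measurable_fnorm_sqr.
  exact: measurable_kernel_integral si.1 (L2_fun_sqi v).1.
- move=> x _; apply: mule_ge0; last by rewrite lee_fin sqr_ge0.
  by apply: integral_ge0 => y _; exact: sq0.
- apply: emeasurable_funM => //; exact: measurable_fun_fubini_tonelli_F mF sq0.
by apply: filterS (kernel_integral_le v si) => x h _.
Qed.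

Lemma integral_operator_fun s v : sq_integrable (mu \x mu)%E s ->
  {ae mu, forall x, L2_fun (integral_operator mu s v) x = kernel_integral s (L2_fun v) x}.
Proof. by move=> si; exact: toL2K (integral_operator_bound v si).1. Qed.

Lemma integral_operator_dot s v : sq_integrable (mu \x mu)%E s ->
  {ae mu, forall x, forall i,
    L2_fun (integral_operator mu s v) x i 0 = L2_dot (toL2 mu (row_of s i x)) v}.
Proof.
move=> si; apply: filterS2 (integral_operator_fun v si) (kernel_integral_dot v si).
by move=> x -> h i; exact: h.
Qed.

Lemma integral_operator_linear s : sq_integrable (mu \x mu)%E s ->
  linear (integral_operator mu s).
Proof.
move=> si a v w; apply/L2_eqP.
apply: filterS3 (integral_operator_dot (a *: v + w) si) (integral_operator_dot v si)
  (filterI (integral_operator_dot w si) (filterI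
  (L2_funD (a *: integral_operator mu s v) (integral_operator mu s w))
  (L2_funZ a (integral_operator mu s v)))) => x Evw Ev [Ew [-> ->]].
apply/matrixP => i j; rewrite (ord1 j).
rewrite (Evw i).
rewrite [RHS]mxDZE.
rewrite L2_dotDr L2_dotZr.
congr (_ * _ + _); apply/esym; [exact: Ev|exact: Ew].
Qed.

Lemma integral_operator_continuous s : sq_integrable (mu \x mu)%E s ->
  continuous (integral_operator mu s).
Proof.
move=> si; apply: (linear_bound_continuous (integral_operator_linear si)) => v.
exact: (integral_operator_bound v si).2.
Qed.

Lemma sq_integrableB d' (U : measurableType d') (m : {measure set U -> \bar R}) a b
    (f g : U -> 'M[R]_(a, b)) :
  sq_integrable m f -> sq_integrable m g -> sq_integrable m (f \- g).
Proof.
move=> fi gi; have := sqi_lin (-1) gi fi.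
rewrite (_ : _ + _ = f \- g)//; apply/funext => x.
by rewrite [LHS](_ : _ = -1 *: g x + f x)// scaleN1r addrC.
Qed.

Lemma integral_operatorB s1 s2 v :
  sq_integrable (mu \x mu)%E s1 -> sq_integrable (mu \x mu)%E s2 ->
  integral_operator mu s1 v - integral_operator mu s2 v =
  integral_operator mu (s1 \- s2) v.
Proof.
move=> s1i s2i; apply/L2_eqP; have sBi := sq_integrableB s1i s2i.
apply: filterS3 (integral_operator_dot v s1i) (integral_operator_dot v s2i)
  (filterI (integral_operator_dot v sBi) (filterI (filterI (ae_rows s1i) (ae_rows s2i))
  (L2_funB (integral_operator mu s1 v) (integral_operator mu s2 v))))
  => x E1 E2 [EB [[r1 r2] ->]].
apply/matrixP => i j; rewrite (ord1 j) mxBE.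
apply: eq_trans (esym (EB i)).
transitivity (L2_dot (toL2 mu (row_of s1 i x)) v - L2_dot (toL2 mu (row_of s2 i x)) v).
  by congr (_ - _); [exact: E1|exact: E2].
rewrite -[- L2_dot _ _]mulN1r -L2_dotZl -L2_dotDl; congr L2_dot.
rewrite scaleN1r; apply/L2_eqP.
have rB : sq_integrable mu (row_of (s1 \- s2) i x).
  rewrite (_ : row_of _ i x = row_of s1 i x \- row_of s2 i x).
    exact: sq_integrableB.
  by apply/funext => y; rewrite /row_of /= !linearB.
apply: filterS3 (toL2K (r1 i)) (toL2K (r2 i)) (filterI (toL2K rB)
  (L2_funB (toL2 mu (row_of s1 i x)) (toL2 mu (row_of s2 i x)))) => y R1 R2 [RB ->].
apply: eq_trans (esym RB); apply: eq_trans (congr2 (fun A B => A - B) R1 R2) _.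
by rewrite /row_of /= !linearB.
Qed.

End hilbert_schmidt.

(** * Measure-preserving composition *)

Section measure_preserving.
Context d1 d2 (T1 : measurableType d1) (T2 : measurableType d2) (R : realType).
Variables (lam : {sigma_finite_measure set T1 -> \bar R})
  (nu : {sigma_finite_measure set T2 -> \bar R}).
Variable psi : T2 -> T1.
Hypothesis mpsi : measurable_fun [set: T2] psi.
Hypothesis pres : forall A, measurable A -> nu (psi @^-1` A) = lam A.
Variable p : nat.

Lemma ge0_integral_preserving (f : T1 -> \bar R) : measurable_fun [set: T1] f ->
  (forall x, 0 <= f x)%E -> (\int[nu]_y f (psi y) = \int[lam]_x f x)%E.
Proof.
move=> mf f0.
rewrite -[LHS](@ge0_integral_pushforward _ _ _ _ _ _ mpsi nu setT f)//.
by apply: eq_measure_integral => A mA _; exact: pres.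
Qed.

Lemma Rintegral_preserving (f : T1 -> R) : measurable_fun [set: T1] f ->
  \int[nu]_y f (psi y) = \int[lam]_x f x.
Proof.
move=> mf; have mE : measurable_fun [set: T1] (EFin \o f) by apply/measurable_EFinP.
rewrite /Rintegral; congr fine; rewrite integralE [RHS]integralE.
congr (_ - _)%E.
  rewrite -[RHS]ge0_integral_preserving//; last exact: measurable_funepos.
  by apply: eq_integral => y _; rewrite !funeposE.
rewrite -[RHS]ge0_integral_preserving//; last exact: measurable_funeneg.
by apply: eq_integral => y _; rewrite !funenegE.
Qed.

Lemma ae_preserving (P : T1 -> Prop) :
  {ae lam, forall x, P x} -> {ae nu, forall y, P (psi y)}.
Proof.
move=> [N [mN N0 sub]]; exists (psi @^-1` N); split.
- by rewrite -[X in measurable X]setTI; exact: mpsi.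
- by rewrite [LHS]pres.
- by move=> y /= nP; exact: sub.
Qed.

(** Here [psi] is measurable and measure preserving on the whole space, which makes changes of
    variables direct; [L2_comp_preserving] connects this with [L2_comp], whose map matters on a
    full-measure set only. *)
Definition preserving_comp (v : L2 lam p 1) : L2 nu p 1 := toL2 nu (L2_fun v \o psi).

Lemma sq_integrable_comp m n (f : T1 -> 'M[R]_(m, n)) :
  sq_integrable lam f -> sq_integrable nu (f \o psi).
Proof.
move=> [mf fi]; split; first by move=> i j; exact: measurableT_comp (mf i j) mpsi.
rewrite (ge0_integral_preserving (f := fun x => (fnorm (f x) ^+ 2)%:E))//.
  exact: measurable_fnorm_sqr.
by move=> x; rewrite lee_fin sqr_ge0.
Qed.

Lemma preserving_comp_fun v :
  {ae nu, forall y, L2_fun (preserving_comp v) y = L2_fun v (psi y)}.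
Proof. by apply: toL2K; apply: sq_integrable_comp; exact: L2_fun_sqi. Qed.

Lemma preserving_comp_linear : linear preserving_comp.
Proof.
move=> a v w; apply/L2_eqP.
apply: filterS3 (preserving_comp_fun (a *: v + w)) (preserving_comp_fun v)
  (filterI (preserving_comp_fun w) (filterI (filterI
  (L2_funD (a *: preserving_comp v) (preserving_comp w))
  (L2_funZ a (preserving_comp v)))
  (filterI (ae_preserving (L2_funD (a *: v) w)) (ae_preserving (L2_funZ a v)))))
  => y E Ev [Ew [[-> ->] [D Z]]].
apply: (eq_trans E); apply: (eq_trans D).
apply: (eq_trans (congr1 (+%R^~ _) Z)); apply/esym.
by apply: congr2 => //; apply: congr1.
Qed.

Lemma preserving_comp_norm v : `|preserving_comp v| = `|v|.
Proof.
apply/eqP; rewrite -(@eqrXn2 _ 2)//; apply/eqP/EFin_inj.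
rewrite -toL2_norm_integral; last by apply: sq_integrable_comp; exact: L2_fun_sqi.
rewrite -L2_norm_integral.
rewrite (ge0_integral_preserving (f := fun x => (fnorm (L2_fun v x) ^+ 2)%:E))//.
  exact: measurable_fnorm_sqr (L2_fun_sqi v).1.
by move=> x; rewrite lee_fin sqr_ge0.
Qed.

Lemma L2_comp_preserving (D : set T2) (g : T2 -> T1) v :
  measurable D -> nu (~` D) = 0%E -> (forall y, D y -> g y = psi y) ->
  L2_comp nu D g v = preserving_comp v.
Proof.
move=> mD D0 gpsi; apply: toL2_eq.
- move=> i j; rewrite (_ : (fun _ => _) = fun y => \1_D y * L2_fun v (psi y) i j).
    apply: measurable_funM; first exact: measurable_indic.
    exact: measurableT_comp ((L2_fun_sqi v).1 i j) mpsi.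
  apply/funext => y; rewrite indicE; case: ifPn => yD.
    by rewrite mul1r gpsi//; exact: set_mem.
  by rewrite mxE mul0r.
- by apply: sq_integrable_comp; exact: L2_fun_sqi.
exists (~` D); split => //; first exact: measurableC.
move=> y /= ne Dy; apply: ne; rewrite mem_set// gpsi//.
Qed.

Variables (s : T1 * T1 -> 'M[R]_p) (s' : T2 * T2 -> 'M[R]_p) (D : set T2).
Hypotheses (mD : measurable D) (D0 : nu (~` D) = 0%E).
Hypothesis si : sq_integrable (lam \x lam)%E s.
Hypothesis s'E : forall z, s' z = if z \in D `*` D then s (psi z.1, psi z.2) else 0.

Let ms' : mx_measurable s'.
Proof.
move=> i j; rewrite (_ : (fun _ => _) =
  fun z => \1_(D `*` D) z * s (psi z.1, psi z.2) i j).
  apply: measurable_funM; first by apply: measurable_indic; exact: measurableX.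
  apply: (measurableT_comp (si.1 i j)).
  by apply: measurable_fun_pair; apply: measurableT_comp.
apply/funext => z; rewrite s'E indicE; case: ifPn => _; first by rewrite mul1r.
by rewrite mxE mul0r.
Qed.

Let sq0 (z : T1 * T1) : (0 <= (fnorm (s z) ^+ 2)%:E)%E.
Proof. by rewrite lee_fin sqr_ge0. Qed.

(** The change of variables is made one variable at a time through Tonelli, since measure
    preservation is known for [psi] and not for the product map. Cutting [s'] off outside [D x D]
    can only decrease the integral. *)
Lemma pullback_kernel_sqi : sq_integrable (nu \x nu)%E s'.
Proof.
split=> //; apply: le_lt_trans si.2.
have ms := measurable_fnorm_sqr (f := s) si.1.
rewrite [leRHS]fubini_tonelli1//.
rewrite fubini_tonelli1//; last 2 first.
- exact: measurable_fnorm_sqr.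
- by move=> z; rewrite lee_fin sqr_ge0.
rewrite -ge0_integral_preserving; last 2 first.
- exact: measurable_fun_fubini_tonelli_F ms sq0.
- by move=> x; apply: integral_ge0.
apply: ge0_le_integral => //.
- by move=> x _; apply: integral_ge0 => y _; rewrite lee_fin sqr_ge0.
- apply: measurable_fun_fubini_tonelli_F; first exact: measurable_fnorm_sqr.
  by move=> z; rewrite lee_fin sqr_ge0.
- exact: measurableT_comp (measurable_fun_fubini_tonelli_F _ ms sq0) mpsi.
move=> x _; rewrite /fubini_F.
have mx : measurable_fun [set: T1] (fun y => (fnorm (s (psi x, y)) ^+ 2)%:E).
  exact: measurableT_comp ms _.
rewrite -[leRHS](ge0_integral_preserving mx) => [|y]; last exact: sq0.
apply: ge0_le_integral => //.
- by move=> y _; rewrite lee_fin sqr_ge0.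
- by apply: measurableT_comp (measurable_fnorm_sqr ms') _.
- exact: measurableT_comp mx mpsi.
move=> y _; rewrite s'E; case: ifPn => // _.
by rewrite -(scale0r 0) fnormZ normr0 mul0r expr0n lee_fin sqr_ge0.
Qed.

(** Substituting [psi y] in the inner integral shows that composition with [psi] intertwines the two
    integral operators. This lets (A1) and (A2), stated on Q, act on the lifted problem. *)
Lemma pullback_kernel_operator v :
  integral_operator nu s' (preserving_comp v) =
  preserving_comp (integral_operator lam s v).
Proof.
apply/L2_eqP.
have aeD : {ae nu, forall x, D x}.
  by exists (~` D); split => //; exact: measurableC.
apply: filterS3 (integral_operator_fun (preserving_comp v) pullback_kernel_sqi)
  (preserving_comp_fun (integral_operator lam s v))
  (filterI aeD (ae_preserving (integral_operator_fun v si)))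
  => x E1 E2 [Dx E3].
apply: (eq_trans E1); apply/esym; apply: (eq_trans E2); apply: (eq_trans E3).
apply/matrixP => i j; rewrite [LHS]mxE [RHS]mxE.
have ms0 : measurable_fun [set: T1] (fun y => (s (psi x, y) *m L2_fun v y) i 0).
  under eq_fun do rewrite mxE.
  apply: measurable_sum => k; apply: measurable_funM.
    exact: measurableT_comp (si.1 i k) _.
  exact: (L2_fun_sqi v).1.
rewrite -(Rintegral_preserving ms0); apply/esym; apply: ae_eq_Rint.
- under eq_fun do rewrite mxE.
  apply: measurable_sum => k; apply: measurable_funM.
    exact: measurableT_comp (ms' i k) _.
  exact: (L2_fun_sqi _).1.
- exact: measurableT_comp ms0 mpsi.
apply: filterS2 aeD (preserving_comp_fun v) => y Dy Ey.
by rewrite s'E mem_set//=; congr (fun_of_matrix (_ *m _) _ _).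
Qed.

End measure_preserving.

(** * Bijections and cells *)

Lemma measure_full d (T : measurableType d) (R : realType)
    (mu : {measure set T -> \bar R}) (A D : set T) :
  measurable A -> measurable D -> mu (~` D) = 0%E -> mu A = mu (A `&` D).
Proof.
move=> mA mD D0; apply/eqP; rewrite eq_le; apply/andP; split; last first.
  by apply: le_measure; rewrite ?inE//; exact: measurableI.
apply: (@le_trans _ _ (mu (A `&` D `|` ~` D))).
  apply: le_measure; rewrite ?inE//.
    by apply: measurableU; [exact: measurableI|exact: measurableC].
  by move=> x Ax; have [Dx|nDx] := pselect (D x); [left|right].
rewrite -[leRHS]adde0 -D0; apply: measureU2; first exact: measurableI.
exact: measurableC.
Qed.

Section bijection.
Context d1 d2 (T1 : measurableType d1) (T2 : measurableType d2) (R : realType).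
Variables (lam : {measure set T1 -> \bar R}) (nu : {measure set T2 -> \bar R}).
Variables (Q Q0 : set T1) (K K0 : set T2) (Phi : T1 -> T2) (Psi : T2 -> T1).
Hypothesis bij : mp_bijection lam nu Q K Q0 K0 Phi Psi.

(** [Phi] is controlled on [Q0] only; giving it a constant value on the null complement yields a map
    that is measurable everywhere and agrees with [Phi] almost everywhere. *)
Lemma measurable_Phi : measurable_fun [set: T1] (Phi \_ Q0).
Proof. exact: (measurable_restrictT _ (mpb_mQ0 bij)).1 (mpb_mPhi bij). Qed.

Lemma measurable_Psi : measurable_fun [set: T2] (Psi \_ K0).
Proof. exact: (measurable_restrictT _ (mpb_mK0 bij)).1 (mpb_mPsi bij). Qed.

Lemma preserving_Phi A : measurable A -> lam ((Phi \_ Q0) @^-1` A) = nu A.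
Proof.
move=> mA; have mQ0 := mpb_mQ0 bij; have mK0 := mpb_mK0 bij.
rewrite (measure_full _ mQ0 (mpb_fullQ bij)); last first.
  by rewrite -[X in measurable X]setTI; exact: measurable_Phi.
rewrite (measure_full mA mK0 (mpb_fullK bij)).
rewrite -(mpb_preserving bij); [|exact: measurableI|exact: subIsetr].
congr (lam _); apply/seteqP; split=> x /=; rewrite /patch.
  by case=> + Qx; rewrite mem_set// => Ax; split=> //; split=> //; exact: (mpb_Phi bij).
by case=> Qx [Ax _]; rewrite mem_set.
Qed.

(** The preservation hypothesis concerns [Phi]. It is applied to the part of the preimage of [A]
    inside [K0], whose own preimage under [Phi] is [A] inside [Q0] because [Psi] inverts [Phi]. *)
Lemma preserving_Psi A : measurable A -> nu ((Psi \_ K0) @^-1` A) = lam A.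
Proof.
move=> mA; have mQ0 := mpb_mQ0 bij; have mK0 := mpb_mK0 bij.
have mpre : measurable ((Psi \_ K0) @^-1` A).
  by rewrite -[X in measurable X]setTI; exact: measurable_Psi.
rewrite (measure_full mpre mK0 (mpb_fullK bij)).
rewrite (measure_full mA mQ0 (mpb_fullQ bij)).
rewrite -(mpb_preserving bij); [|exact: measurableI|exact: subIsetr].
congr (lam _); apply/seteqP; split=> x /=; rewrite /patch.
  case=> Qx [+ KPx]; rewrite mem_set ?(mpb_PhiK bij)//.
by case=> Ax Qx; have KPx := mpb_Phi bij Qx; rewrite mem_set ?(mpb_PhiK bij).
Qed.

End bijection.

Lemma preserving_compK d1 d2 (T1 : measurableType d1) (T2 : measurableType d2)
    (R : realType) (lam : {sigma_finite_measure set T1 -> \bar R})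
    (nu : {sigma_finite_measure set T2 -> \bar R}) (phi : T1 -> T2) (psi : T2 -> T1)
    (p : nat) (w : L2 nu p 1) :
  measurable_fun [set: T1] phi -> measurable_fun [set: T2] psi ->
  (forall A, measurable A -> lam (phi @^-1` A) = nu A) ->
  (forall A, measurable A -> nu (psi @^-1` A) = lam A) ->
  {ae nu, forall y, phi (psi y) = y} ->
  preserving_comp nu psi (preserving_comp lam phi w) = w.
Proof.
move=> mphi mpsi prphi prpsi phiK; apply/L2_eqP.
apply: filterS3 (preserving_comp_fun mpsi prpsi (preserving_comp lam phi w))
  (ae_preserving mpsi prpsi (preserving_comp_fun mphi prphi w)) phiK => y E1 E2 E3.
by apply: (eq_trans E1); apply: (eq_trans E2); rewrite E3.
Qed.

Lemma sq_integrable_sum d (T : measurableType d) (R : realType)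
    (mu : {measure set T -> \bar R}) m n (I : Type) (r : seq I)
    (F : I -> T -> 'M[R]_(m, n)) :
  (forall i, sq_integrable mu (F i)) -> sq_integrable mu (fun x => \sum_(i <- r) F i x).
Proof.
move=> Fi; elim: r => [|i r IH].
  by under eq_fun do rewrite big_nil; exact: sqi0.
under eq_fun do rewrite big_cons.
have := sqi_lin 1 (Fi i) IH; rewrite (_ : _ + _ = fun x => F i x + \sum_(j <- r) F j x)//.
by apply/funext => x; rewrite [LHS](_ : _ = 1 *: F i x + \sum_(j <- r) F j x)// scale1r.
Qed.

Lemma sq_integrable_indic d (T : measurableType d) (R : realType)
    (mu : {measure set T -> \bar R}) m n (E : set T) (c : 'M[R]_(m, n)) :
  (mu [set: T] < +oo)%E -> measurable E -> sq_integrable mu (fun x => \1_E x *: c).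
Proof.
move=> fin mE; have mf : mx_measurable (fun x => \1_E x *: c).
  move=> i j; under eq_fun do rewrite mxE.
  by apply: measurable_funM => //; exact: measurable_indic.
split=> //; apply: (@le_lt_trans _ _ (\int[mu]_x (fnorm c ^+ 2)%:E)%E).
  apply: ge0_le_integral => //.
  - by move=> x _; rewrite lee_fin sqr_ge0.
  - exact: measurable_fnorm_sqr.
  move=> x _; rewrite lee_fin ler_pXn2r ?nnegrE ?fnorm_ge0// fnormZ.
  by rewrite ler_piMl ?fnorm_ge0// indicE; case: (_ \in _); rewrite ?normr1 ?normr0.
rewrite integral_cst//; apply: lte_mul_pinfty => //; rewrite lee_fin sqr_ge0//.
Qed.

Section cells.
Context (R : realType) (k d : nat).
Variables (q : R) (f : 'I_k -> 'cV[R]_d -> 'cV[R]_d) (K : set 'cV[R]_d).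
Hypotheses (hf : forall i, similitude q (f i)) (q0 : 0 < q) (cK : compact K).

Lemma similitude_continuous i : continuous (f i).
Proof.
move=> x; apply/(@cvgrPdist_lt _ _ _ (nbhs x) (nbhs_filter x) (f i) (f i x)) => e e0.
(* Similitudes are Euclidean while the topology comes from the sup norm; the comparison costs
   [sqrt d]. The added 1 keeps [D] positive for [d = 0] and makes the final inequality strict. *)
pose D : R := q * Num.sqrt d%:R + 1.
have D0 : 0 < D by rewrite ltr_wpDl// mulr_ge0 ?sqrtr_ge0// ltW.
apply/nbhs_ballP; exists (e / D); first exact: divr_gt0.
move=> y xy; suff : ball (f i x) e (f i y) by rewrite mx_norm_ball.
split=> // a b; rewrite /ball /= -mxBE.
apply: le_lt_trans (normr_entry_le_fnorm _ _ _) _; rewrite hf.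
have eD0 : 0 < e / D by exact: divr_gt0.
have sd0 : 0 <= Num.sqrt d%:R * (e / D) by rewrite mulr_ge0 ?sqrtr_ge0 ?ltW.
apply: (@le_lt_trans _ _ (q * (Num.sqrt d%:R * (e / D)))).
  rewrite ler_pM2l// -(@ler_pXn2r _ 2)// ?nnegrE ?fnorm_ge0//.
  rewrite fnorm_col exprMn sqr_sqrtr// -[d in d%:R]card_ord -sumr_const mulr_suml.
  apply: ler_sum => j _; rewrite mul1r -real_normK ?num_real//.
  rewrite ler_pXn2r ?nnegrE ?(ltW eD0)// mxBE.
  by case: xy => _ /(_ j 0); rewrite /ball /= => /ltW.
by rewrite mulrA mulrCA gtr_pMr// ltr_pdivrMr// mul1r /D ltrDl.
Qed.

(** A cell is a continuous image of a compact set, hence closed, hence Borel. *)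
Lemma measurable_cell (w : seq 'I_k) : measurable (cell f K w : set (borel_space R d)).
Proof.
have cw : continuous (word_map f w).
  elim: w => [|i w IH]; first by move=> x.
  by move=> x; apply: continuous_comp; [exact: IH|exact: similitude_continuous].
have : closed (cell f K w).
  apply: compact_closed; first exact: norm_hausdorff.
  by apply: continuous_compact => //; exact: continuous_subspaceT.
rewrite -openC => oC; rewrite -[cell f K w]setCK; apply: measurableC.
exact: sub_sigma_algebra.
Qed.

Lemma step_kernel_sqi p (nu : probability (borel_space R d) R) m
    (s : borel_space R d * borel_space R d -> 'M[R]_p) :
  sq_integrable (nu \x nu)%E (step_kernel f K nu m s).
Proof.
apply: sq_integrable_sum => w; apply: sq_integrable_sum => v.
apply: sq_integrable_indic; last by apply: measurableX; exact: measurable_cell.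
have : (nu [set: _] * nu [set: _] < +oo)%E by rewrite probability_setT mule1 ltry.
by rewrite -(product_measure1E nu nu measurableT measurableT) setXTT.
Qed.

End cells.

(** * Rate of convergence *)

Lemma is_derive_right_quotient (R : realType) (W : normedModType R) (v : R -> W)
    (t : R) (l : W) :
  is_derive t 1 v l -> h^-1 *: (v (t + h) - v t) @[h --> 0^'+] --> l.
Proof.
move=> [dv <-].
apply: cvg_trans (cvg_dnbhs_at_right (dv : _ --> 'D_1 v t)).
apply: near_eq_cvg; near=> h => /=.
by rewrite [h *: 1]mulr1 (addrC h t).
Unshelve. all: by end_near. Qed.

Lemma is_derive_continuous (R : realType) (W : normedModType R) (v : R -> W)
    (t : R) (l : W) :
  is_derive t 1 v l -> {for t, continuous v}.
Proof.
by move=> [/derivable1_diffP dv _]; exact: differentiable_continuous.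
Qed.

Section convergence_rate.
Context (R : realType) (V : completeNormedModType R) (W X : normedModType R).
Variables (S : R -> V -> V) (D : set V) (A : V -> V) (iota : {linear X -> V}).
Variables (D0 : set X) (Ae : R -> V -> V) (r : R -> R).
Hypotheses (hS : C0_semigroup S) (gS : generates D A S) (linA : linear_on D A).
Hypotheses (linAe : forall eps, 0 < eps -> linear (Ae eps))
  (contAe : forall eps, 0 < eps -> continuous (Ae eps)).
Hypotheses (cont_iota : continuous iota) (iotaD : range iota `<=` D).
Hypotheses (denseD0 : dense D0) (stable : uniformly_stable Ae).
Hypothesis consistent : forall eps x, 0 < eps -> D0 x ->
  `|Ae eps (iota x) - A (iota x)| <= r eps * `|x|.
Variables (u0 : X) (tau b : R).
Let u t := S t (iota u0).
Hypothesis uX : forall t, 0 <= t <= tau -> exists2 x : X, iota x = u t & `|x| <= b.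

(** Strong continuity is given at time 0 only, and the Gronwall lemma needs left limits at positive
    times. Since [u s] comes from a ball of radius [b] in [X], [A (u s)] is bounded uniformly in
    [s], and [semigroup_increment] turns this into a Lipschitz bound. *)
Lemma orbit_lipschitz : exists delta L, [/\ 0 < delta, 0 <= L &
  forall s t, 0 <= s -> s <= t -> t <= tau -> t - s <= delta ->
    `|u t - u s| <= L * (t - s)].
Proof.
have [delta [C [delta0 C0 near0]]] := C0_semigroup_bounded_near0 hS.
have [LA LA0 HA] := generator_bounded_on_range hS gS (linAe ltr01) (contAe ltr01)
  cont_iota iotaD denseD0 delta0 C0 near0 (fun x => consistent ltr01 (x := x)).
exists delta, (C * (LA * `|b|)); split => // [|s t s0 st ttau tsd].
  by rewrite mulr_ge0 ?(ltW C0)// mulr_ge0// ltW.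
have ts0 : 0 <= t - s by rewrite subr_ge0.
have [x xu xb] : exists2 x : X, iota x = u s & `|x| <= b.
  by apply: uX; rewrite s0 (le_trans st).
rewrite /u -{1}(subrK s t) (C0_add hS)// -/(u s) -xu.
have Dx : D (iota x) by apply: iotaD; exists x.
apply: le_trans (semigroup_increment hS gS C0 near0 Dx _) _; first by rewrite ts0.
rewrite mulrAC ler_wpM2r// ler_wpM2l// ?(ltW C0)//.
apply: le_trans (HA x) _; rewrite ler_wpM2l// ?(ltW LA0)//.
exact: le_trans xb (ler_norm b).
Qed.

Lemma orbit_cvg_left t : 0 < t <= tau -> u s @[s --> t^'-] --> u t.
Proof.
move=> /andP[t0 ttau]; have [delta [L [delta0 L0 lip]]] := orbit_lipschitz.
apply/cvgrPdist_le => e e0; near=> s.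
have st : s <= t by near: s; exact: nbhs_left_le.
have s0 : 0 <= s by near: s; exact: nbhs_left_ge.
have sd : t - delta <= s by near: s; apply: nbhs_left_ge; rewrite ltrBlDr ltrDl.
have se : t - e / (L + 1) <= s.
  near: s; apply: nbhs_left_ge; rewrite ltrBlDr ltrDl divr_gt0//.
  by rewrite ltr_wpDl.
apply: le_trans (lip s t s0 st ttau _) _; first by lra.
have L1 : 0 < L + 1 by rewrite ltr_wpDl.
apply: (@le_trans _ _ ((L + 1) * (t - s))); first by rewrite ler_wpM2r ?lerDl// subr_ge0.
by rewrite -ler_pdivlMl// mulrC; lra.
Unshelve. all: by end_near. Qed.

Variables (T : {linear W -> V}) (I : Type) (B : R -> I -> W -> W).
Variables (w0 : R -> I -> W) (um : R -> I -> R -> W) (kap eta : R -> I -> R).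
Variables (E : R) (rho : R -> R).
Hypothesis isoT : forall w, `|T w| = `|w|.
Hypothesis kap0 : forall eps m, 0 <= kap eps m.
Hypothesis perturb : forall eps m w, 0 < eps ->
  `|T (B eps m w) - Ae eps (T w)| <= kap eps m * `|w|.
Hypothesis sol : forall eps m, 0 < eps ->
  cauchy_solution (B eps m) (w0 eps m) (um eps m).
Hypothesis small : forall eps m, 0 < eps ->
  `|T (w0 eps m) - iota u0| + kap eps m <= eta eps m.
Hypothesis etaE : forall eps m, 0 < eps -> eta eps m <= E.
Hypothesis rate : forall eps, 0 < eps -> r eps <= rho eps.
Hypothesis rho0 : forall eps, 0 < eps -> 0 <= rho eps.

(** In the application [kap] is the Hilbert-Schmidt norm of the kernel error, [eta] is
    [C q^(alpha m)], [E] is [C] and [rho] is [C eps^beta]. *)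
Theorem convergence_rate : exists2 CT, 0 <= CT & forall eps m t, 0 < eps ->
  0 <= t <= tau -> `|T (um eps m t) - u t| <= CT * (rho eps + eta eps m).
Proof.
have [M [w [M1 stab]]] := stable.
have M0 : 0 < M by exact: lt_le_trans M1.
have [delta [C [delta0 C0 near0]]] := C0_semigroup_bounded_near0 hS.
have [Li Li0 Hi] : exists2 L, 0 < L & forall x, `|iota x| <= L * `|x|.
  by apply: continuous_linear_bound => // a x y; rewrite linearP.
have contT : continuous T.
  by apply: (@linear_bound_continuous _ _ _ T 1) => [a x y|x]; rewrite ?linearP ?mul1r ?isoT.
(* The Gronwall lemma asks for a nonnegative rate; likewise absolute values of [b], [E] and [tau]
   avoid sign assumptions. *)
pose w' := Num.max w 0; have w'0 : 0 <= w' by rewrite le_max lexx orbT.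
pose bb := `|b|.
(* The three summands come from the initial error, the kernel error acting on [u], and the
   consistency error; the kernel error acting on [e] gives the term with [E] in the exponent. *)
pose CT := (M + M * (Li * bb) + M * bb) * expR ((w' + M * `|E| + 1) * `|tau|).
have bb0 : 0 <= bb by exact: normr_ge0.
have CT0 : 0 <= CT.
  by rewrite mulr_ge0 ?expR_ge0// !addr_ge0 ?mulr_ge0// ltW.
exists CT => // eps m t eps0 t0.
have [St [hSt gSt bSt]] := stab eps eps0.
have [v0 vr vd] := sol m eps0.
have eta0 : 0 <= eta eps m by apply: le_trans (small m eps0); rewrite addr_ge0.
have kapeta : kap eps m <= eta eps m by apply: le_trans (small m eps0); rewrite lerDr.
have kapE : kap eps m <= `|E|.
  exact: le_trans (le_trans kapeta (etaE m eps0)) (ler_norm E).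
pose e s := T (um eps m s) - u s.
pose e' s := T (B eps m (um eps m s)) - A (u s).
have uD s : 0 <= s <= tau -> D (u s).
  by move=> /uX[x <- _]; apply: iotaD; exists x.
have ub s : 0 <= s <= tau -> `|u s| <= Li * bb.
  move=> /uX[x <- xb]; apply: le_trans (Hi x) _; rewrite ler_wpM2l ?(ltW Li0)//.
  exact: le_trans xb (ler_norm b).
have er : e s @[s --> 0^'+] --> e 0.
  apply: cvgB; last by rewrite /u (C0_0 hS); exact: (@C0_strong _ _ _ hS (iota u0)).
  by rewrite v0; apply: continuous_cvg => //; exact: contT.
have el s : 0 < s <= tau -> e x @[x --> s^'-] --> e s.
  move=> s0; apply: cvgB; last exact: orbit_cvg_left.
  apply: continuous_cvg; first exact: contT.
  have /andP[s00 _] := s0.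
  by apply: cvg_at_left_filter; exact: is_derive_continuous (vd s s00).
have ed s : 0 < s < tau -> h^-1 *: (e (s + h) - e s) @[h --> 0^'+] --> e' s.
  move=> /andP[s0 stau].
  have q1 : T (h^-1 *: (um eps m (s + h) - um eps m s)) @[h --> 0^'+]
      --> T (B eps m (um eps m s)).
    by apply: continuous_cvg; [exact: contT|exact: is_derive_right_quotient (vd s s0)].
  have Ds : D (u s) by apply: uD; rewrite !ltW.
  apply: cvg_trans (cvgB q1 (generator_quotient gS Ds)).
  apply: near_eq_cvg; near=> h; rewrite !fctE.
  have h0 : 0 <= h by near: h; exact: nbhs_right_ge.
  rewrite linearZ linearB -scalerBr /e /u (addrC s h) (C0_add hS) ?(ltW s0)//.
  by congr (_ *: _); rewrite !opprD !opprK [LHS]addrACA.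
have eB s : 0 < s < tau ->
    `|e' s - Ae eps (e s)| <= `|E| * `|e s| + (eta eps m * (Li * bb) + rho eps * bb).
  move=> /andP[s0 stau]; have s0tau : 0 <= s <= tau by rewrite !ltW.
  have [x xu xb] := uX s0tau.
  have linB' y z : Ae eps (y - z) = Ae eps y - Ae eps z.
    by have := linAe eps0 (-1) z y; rewrite !scaleN1r => BB; rewrite addrC BB addrC.
  have -> : e' s - Ae eps (e s) = (T (B eps m (um eps m s)) - Ae eps (T (um eps m s)))
      + (Ae eps (u s) - A (u s)).
    by rewrite /e' /e linB' opprD opprK addrACA [- A _ + _]addrC.
  apply: le_trans (ler_normD _ _) _.
  have p1 := perturb m (um eps m s) eps0.
  (* No a priori bound on the discrete solution is available, so it is estimated through the error
     itself. *)
  have p2 : `|um eps m s| <= `|e s| + Li * bb.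
    rewrite -isoT -(subrK (u s) (T _)); apply: le_trans (ler_normD _ _) _.
    by rewrite lerD2l ub.
  have p3 : `|Ae eps (u s) - A (u s)| <= rho eps * bb.
    rewrite -xu; apply: le_trans (consistent_on_range hS gS linA (linAe eps0) (contAe eps0)
      cont_iota iotaD denseD0 delta0 C0 near0 (fun x => consistent eps0 (x := x)) x) _.
    apply: (@le_trans _ _ (rho eps * `|x|)); first by rewrite ler_wpM2r// rate.
    by rewrite ler_wpM2l ?rho0// (le_trans xb)// ler_norm.
  rewrite addrA; apply: lerD p3; apply: le_trans p1 _.
  apply: le_trans (ler_wpM2l (kap0 eps m) p2) _.
  rewrite mulrDr; apply: lerD; first by rewrite ler_wpM2r.
  by rewrite ler_wpM2r// mulr_ge0// ltW.
have stab' h v : 0 <= h -> `|St h v| <= M * expR (w' * h) * `|v|.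
  move=> h0; apply: le_trans (bSt h v h0) _.
  by rewrite ler_wpM2r// ler_wpM2l ?(ltW M0)// ler_expR ler_wpM2r// le_max lexx.
have beta0 : 0 <= eta eps m * (Li * bb) + rho eps * bb.
  by rewrite addr_ge0 ?mulr_ge0 ?rho0// ltW.
have := perturbed_semigroup_bound hSt gSt w'0 M0 (normr_ge0 E) beta0 stab' er el ed eB t0.
move=> /le_trans; apply.
have e0 : `|e 0| <= eta eps m.
  apply: le_trans (small m eps0); rewrite /e v0 /u (C0_0 hS) lerDl//.
apply: (@le_trans _ _ ((M * eta eps m + M * (eta eps m * (Li * bb) + rho eps * bb)) *
   expR ((w' + M * `|E| + 1) * `|tau|))).
  apply: ler_pM => //.
  - by rewrite addr_ge0// mulr_ge0// ltW.
  - by rewrite lerD2r ler_pM2l.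
  rewrite ler_expR ler_wpM2l//.
    by rewrite !addr_ge0// mulr_ge0// ltW.
  by have /andP[_ ttau] := t0; rewrite (le_trans ttau)// ler_norm.
rewrite /CT mulrAC ler_wpM2r ?expR_ge0//.
have Mp : 0 <= M by exact: ltW.
have r0 := rho0 eps0.
have h1 : 0 <= M * rho eps by rewrite mulr_ge0.
have h2 : 0 <= M * (Li * bb) * rho eps by rewrite !mulr_ge0// ltW.
have h3 : 0 <= M * bb * eta eps m by rewrite !mulr_ge0.
lra.
Unshelve. all: by end_near. Qed.

End convergence_rate.

(** * Transfer to the self-similar set and balanced choices of the parameters *)

Lemma C_norm_le (R : realType) (V : normedModType R) (tau : R) (v : R -> V) (c : R) :
  (forall t, 0 <= t <= tau -> `|v t| <= c) -> (C_norm tau v <= c%:E)%E.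
Proof.
move=> vc; apply: ge_ereal_sup => _ [t /= + <-]; rewrite in_itv /= => t0.
by rewrite lee_fin vc.
Qed.

Lemma contraction_power_cells (R : realType) (k : nat) (q : R) (m : nat) :
  (1 < k)%N -> 0 < q < 1 ->
  q ^+ m = ((k ^ m)%N%:R : R) `^ (- (ln k%:R / ln q^-1)^-1).
Proof.
move=> k1 /andP[q0 q1].
have k0 : 0 < k%:R :> R by rewrite ltr0n ltnW.
have lnk : 0 < ln k%:R :> R by rewrite ln_gt0// ltr1n.
have lnq : 0 < ln q^-1 by rewrite ln_gt0// invf_gt1.
have -> : (k ^ m)%N%:R `^ (- (ln k%:R / ln q^-1)^-1) =
    expR (- (ln k%:R / ln q^-1)^-1 * (ln k%:R *+ m)) :> R.
  by rewrite natrX /powR expf_eq0 (gt_eqF k0) andbF lnXn.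
have -> : - (ln k%:R / ln q^-1)^-1 * (ln k%:R *+ m) = ln q *+ m.
  rewrite -(mulr_natr (ln k%:R)) -(mulr_natr (ln q)) -[ln q]opprK -lnV ?posrE//.
  by field; rewrite !gt_eqF.
by rewrite -lnXn// lnK// posrE exprn_gt0.
Qed.

Theorem corollary5p5 (R : realType) (k d p : nat)
  (hk : (1 < k)%N) (hp : (0 < p)%N)
  (q : R) (hq : 0 < q < 1)
  (f : 'I_k -> 'cV[R]_d -> 'cV[R]_d) (hf : forall i, similitude q (f i))
  (K : set 'cV[R]_d) (hK : attractor f K)
  (mu : probability (Sigma hk) R) (hmu : uniform_bernoulli mu)
  (nu : probability (borel_space R d) R)
  (hnu : forall B, measurable B ->
    nu B = pushforward mu (natural_projection f K : Sigma hk -> borel_space R d) B)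
  (hoverlap : mu.-negligible (overlap_set f K : set (Sigma hk)))
  (Q0 : set (measurableTypeR R)) (K0 : set (borel_space R d))
  (Phi : measurableTypeR R -> borel_space R d)
  (Psi : borel_space R d -> measurableTypeR R)
  (hPhi : mp_bijection (unit_lebesgue R) nu unit_itv K Q0 K0 Phi Psi)
  (hPhi_pi : {ae mu, forall s : Sigma hk,
    Phi (natural_projection (@interval_map R k) unit_itv s) =
    natural_projection f K s})
  (D : set (L2Q R p))
  (A : L2Q R p -> L2Q R p)
  (hDsub : subspace_set D) (hDdense : dense D) (hAlin : linear_on D A)
  (S : R -> L2Q R p -> L2Q R p)
  (hS : C0_semigroup S) (hAS : generates D A S)
  (sigma : R -> measurableTypeR R * measurableTypeR R -> 'M[R]_p)
  (hsigma : forall eps : R, 0 < eps ->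
    sq_integrable (unit_lebesgue R \x unit_lebesgue R)%E (sigma eps))
  (X : completeNormedModType R) (iota : {linear X -> L2Q R p})
  (hiota_inj : injective iota) (hiota_cont : continuous iota)
  (hiota_dense : dense (range iota)) (hXD : range iota `<=` D)
  (hA1 : uniformly_stable (fun eps : R => integral_operator (unit_lebesgue R) (sigma eps)))
  (D0 : set X) (hD0sub : subspace_set D0) (hD0dense : dense D0)
  (hD0core : core D A (iota @` D0))
  (r : R -> R) (hr : r eps @[eps --> 0^'+] --> 0)
  (hA2 : forall (eps : R) (phi : X), 0 < eps -> D0 phi ->
    `|integral_operator (unit_lebesgue R) (sigma eps) (iota phi) - A (iota phi)|
    <= r eps * `|phi|)
  (u0 : X) :
  let u := mild_solution S (iota u0) in
  let Tinv (v : L2Q R p) : L2 nu p 1 := L2_comp nu K0 Psi v in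
  let P (m : nat) : L2 nu p 1 -> L2 nu p 1 := step_projection f K m in
  let sigmaT (eps : R) := lifted_kernel K0 Psi (sigma eps) in
  let sigmaTm (eps : R) (m : nat) := step_kernel f K nu m (sigmaT eps) in
  forall (um : R -> nat -> R -> L2 nu p 1)
  (hum : forall (eps : R) (m : nat), 0 < eps ->
    cauchy_solution (integral_operator nu (sigmaTm eps m))
      (P m (Tinv (iota u0))) (um eps m))
  (alpha beta C : R) (halpha : 0 < alpha) (hbeta : 0 < beta) (hC : 0 < C)
  (happrox : forall (eps : R) (m : nat), 0 < eps ->
    `|Tinv (iota u0) - P m (Tinv (iota u0))|
    + `|toL2 (nu \x nu)%E (sigmaT eps \- sigmaTm eps m)|
    <= C * q `^ (alpha * m%:R))
  (hrate : forall eps : R, 0 < eps -> r eps <= C * eps `^ beta)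
  (tau : R) (htau : 0 < tau)
  (huX : exists b : R, forall t, 0 <= t <= tau ->
    exists2 x : X, iota x = u t & `|x| <= b),
  let err (eps : R) (m : nat) := C_norm tau (fun t => um eps m t - Tinv (u t)) in
  let N (m : nat) : R := (k ^ m)%N%:R in
  let s := ln k%:R / ln q^-1 in
  [/\ exists CT : R, forall (eps : R) (m : nat), 0 < eps ->
        (err eps m <= (CT * (eps `^ beta + q `^ (alpha * m%:R)))%:E)%E,
      exists CT : R, forall (eps : R) (m : nat), 0 < eps ->
        q `^ (alpha * m%:R) <= eps `^ beta ->
        eps `^ beta < q `^ (alpha * (m%:R - 1)) ->
        (err eps m <= (CT * eps `^ beta)%:E)%E,
      forall m, q ^+ m = N m `^ (- s^-1) &
      forall eps : nat -> R, (forall m, 0 < eps m) ->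
        asymp eps (fun m => N m `^ (- (alpha / (beta * s)))) ->
        exists CT : R, forall m,
          (err (eps m) m <= (CT * N m `^ (- (alpha / s)))%:E)%E].

Proof.
move=> u Tinv P sigmaT sigmaTm um hum alpha beta C halpha hbeta hC happrox hrate
  tau htau [b huX] err N s.
have [q0 q1] := andP hq.
have cK : compact K by case: hK.
pose lam := unit_lebesgue R.
pose psi := Psi \_ K0; pose phi := Phi \_ Q0.
have mpsi : measurable_fun [set: borel_space R d] psi := measurable_Psi hPhi.
have mphi : measurable_fun [set: measurableTypeR R] phi := measurable_Phi hPhi.
have prpsi := preserving_Psi hPhi; have prphi := preserving_Phi hPhi.
have mK0 := mpb_mK0 hPhi; have mQ0 := mpb_mQ0 hPhi.
have psiE y : K0 y -> Psi y = psi y by move=> Ky; rewrite /psi /patch mem_set.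
have phiE x : Q0 x -> Phi x = phi x by move=> Qx; rewrite /phi /patch mem_set.
have TinvE v : Tinv v = preserving_comp nu psi v.
  by apply: (L2_comp_preserving mpsi prpsi) => //; exact: (mpb_fullK hPhi).
pose T0 : L2 nu p 1 -> L2Q R p := @preserving_comp _ _ _ _ _ _ lam phi p.
have linT0 : linear T0 by exact: (preserving_comp_linear mphi prphi).
pose T : {linear L2 nu p 1 -> L2Q R p} :=
  HB.pack T0 (GRing.isLinear.Build _ _ _ _ _ linT0).
have isoT w : `|T w| = `|w| by exact: (preserving_comp_norm mphi prphi).
have TK v : T (Tinv v) = v.
  rewrite TinvE; change (preserving_comp lam phi (preserving_comp nu psi v) = v).
  apply: (preserving_compK _ mpsi mphi prpsi prphi).
  exists (~` Q0); split; [exact: measurableC|exact: (mpb_fullQ hPhi)|].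
  move=> x /= ne Qx; apply: ne; rewrite -(phiE _ Qx) -psiE ?(mpb_PhiK hPhi)//.
  exact: (mpb_Phi hPhi).
have TinvK w : Tinv (T w) = w.
  rewrite TinvE; change (preserving_comp nu psi (preserving_comp lam phi w) = w).
  apply: (preserving_compK _ mphi mpsi prphi prpsi).
  exists (~` K0); split; [exact: measurableC|exact: (mpb_fullK hPhi)|].
  move=> y /= ne Ky; apply: ne; rewrite -(psiE _ Ky) -phiE ?(mpb_PsiK hPhi)//.
  exact: (mpb_Psi hPhi).
have sTE eps z : sigmaT eps z =
    if z \in K0 `*` K0 then sigma eps (psi z.1, psi z.2) else 0.
  rewrite /sigmaT /lifted_kernel; case: ifPn => // /set_mem[K1 K2].
  by rewrite (psiE _ K1) (psiE _ K2).
have sTi eps : 0 < eps -> sq_integrable (nu \x nu)%E (sigmaT eps).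
  move=> eps0.
  exact: (pullback_kernel_sqi mpsi prpsi mK0 (hsigma eps eps0) (sTE eps)).
have sTmi eps m : sq_integrable (nu \x nu)%E (sigmaTm eps m).
  exact: (step_kernel_sqi hf q0 cK).
have perturb eps m w : 0 < eps ->
    `|T (integral_operator nu (sigmaTm eps m) w)
      - integral_operator lam (sigma eps) (T w)|
    <= `|toL2 (nu \x nu)%E (sigmaT eps \- sigmaTm eps m)| * `|w|.
  move=> eps0.
  (* [T] conjugates the lifted operator to [A_eps], so the perturbation is the image under an
     isometry of a Hilbert-Schmidt operator on K. *)
  have conj : integral_operator lam (sigma eps) (T w) =
      T (integral_operator nu (sigmaT eps) w).
    rewrite -{2}(TinvK w) (TinvE (T w)).
    rewrite (pullback_kernel_operator mpsi prpsi mK0 (mpb_fullK hPhi)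
      (hsigma eps eps0) (sTE eps)).
    by rewrite -TinvE TK.
  rewrite conj -linearB isoT distrC (integral_operatorB _ (sTi eps eps0) (sTmi eps m)).
  apply: (integral_operator_bound _ _).2.
  exact: sq_integrableB (sTi eps eps0) (sTmi eps m).
have [CT CT0 HCT] : exists2 CT, 0 <= CT & forall (eps : R) (m : nat) t, 0 < eps ->
    0 <= t <= tau -> `|T (um eps m t) - u t| <=
      CT * (C * eps `^ beta + C * q `^ (alpha * m%:R)).
  apply: (@convergence_rate R (L2Q R p) (L2 nu p 1) X S D A iota D0
    (fun eps => integral_operator lam (sigma eps)) r hS hAS hAlin _ _
    hiota_cont hXD hD0dense hA1 _ u0 tau b huX T nat
    (fun eps m => integral_operator nu (sigmaTm eps m))
    (fun eps m => P m (Tinv (iota u0))) um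
    (fun eps m => `|toL2 (nu \x nu)%E (sigmaT eps \- sigmaTm eps m)|)
    (fun eps m => C * q `^ (alpha * m%:R)) C (fun eps => C * eps `^ beta)) => //.
  - move=> eps eps0; exact: (integral_operator_linear (hsigma eps eps0)).
  - move=> eps eps0; exact: (integral_operator_continuous (hsigma eps eps0)).
  - move=> eps m eps0; rewrite -{2}(TK (iota u0)) -linearB isoT distrC.
    exact: happrox.
  (* [q^(alpha m) <= q^0 = 1], hence the bound [C] that is uniform in [m]. *)
  - move=> eps m eps0; rewrite ger_pMr// -[leRHS](powRr0 q).
    by apply: ger_powR; rewrite ?q0 ?(ltW q1)// mulr_ge0// ltW.
  - by move=> eps eps0; rewrite mulr_ge0 ?powR_ge0// ltW.
have errP eps m c : (forall t, 0 <= t <= tau -> `|T (um eps m t) - u t| <= c) ->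
    (err eps m <= c%:E)%E.
  move=> H; apply: C_norm_le => t t0.
  by rewrite -isoT linearB TK H.
have rate1 eps m : 0 < eps ->
    (err eps m <= (CT * C * (eps `^ beta + q `^ (alpha * m%:R)))%:E)%E.
  by move=> eps0; apply: errP => t t0; rewrite -mulrA mulrDr HCT.
have CTC0 : 0 <= CT * C by rewrite mulr_ge0// ltW.
have Nq m : q ^+ m = N m `^ (- s^-1) by exact: contraction_power_cells.
split=> //.
- by exists (CT * C).
(* The two terms of the rate are each at most [eps^beta]. *)
- exists (CT * C * 2) => eps m eps0 le1 _; apply: le_trans (rate1 eps m eps0) _.
  by rewrite lee_fin -[leRHS]mulrA ler_wpM2l//; lra.
move=> eps eps0 [c1 [c2 [c10 c20 epsN]]].
(* Raising [eps m <= c2 N^(-alpha/(beta s))] to the power [beta] gives [c2^beta N^(-alpha/s)]; the 1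
   accounts for [q^(alpha m) = N^(-alpha/s)]. *)
exists (CT * C * (c2 `^ beta + 1)) => m; apply: le_trans (rate1 _ m (eps0 m)) _.
rewrite lee_fin -[leRHS]mulrA ler_wpM2l//.
have N0 : 0 < N m by rewrite ltr0n expn_gt0 ltnW.
have s0 : 0 < s by rewrite divr_gt0// ln_gt0 ?ltr1n// invf_gt1.
have qN : q `^ (alpha * m%:R) = N m `^ (- (alpha / s)).
  by rewrite mulrC powRrM powR_mulrn ?(ltW q0)// Nq -powRrM mulNr mulrC.
rewrite mulrDl mul1r qN lerD2r.
have NE : N m `^ (- (alpha / s)) = (N m `^ (- (alpha / (beta * s)))) `^ beta.
  by rewrite -powRrM; congr (_ `^ _); field; rewrite !gt_eqF.
rewrite NE -powRM ?powR_ge0 ?(ltW c20)//.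
have /andP[_ epsm] := epsN m.
apply: ge0_ler_powR; first exact: ltW.
- by rewrite nnegrE ltW.
- by rewrite nnegrE mulr_ge0 ?powR_ge0// ltW.
- by move: epsm; rewrite ler_pdivrMr ?powR_gt0.
Qed.
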